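(* Let $E$ be a finite set, $\mathcal X \subseteq 2^E$, and $w\colon E \to \mathbb R_{>0}$. Suppose that there is a constant $c$ such that, for every weight function $w'\colon E \to \mathbb R$ and every positive integer $k$, there is a top-$k$ enumeration algorithm for $(E, \mathcal X, w', k)$ that runs in $O((|E|+k)^c)$ time. Then there is an $\alpha$-approximation algorithm for \textsc{Max-Sum Diverse Solutions} (on $E$, $\mathcal X$, $w$, $k$) that runs in $O((|E|+k)^c\,|E|\,k^2 \log k)$ time, where $\alpha = \max(1 - 2/k, 1/2)$. Moreover, if in addition there is a polynomial-time exact algorithm for \textsc{Max-Sum Diverse Solutions} whenever $k$ is a constant, then \textsc{Max-Sum Diverse Solutions} admits a polynomial-time approximation scheme.
   Context: For $Z \subseteq E$ write $w(Z) = \sum_{x \in Z} w(x)$, and $X \triangle Y$ is the symmetric difference. The weighted Hamming distance is $d_w(X,Y) = w(X \triangle Y)$. For a collection $\mathcal Y = \{Y_1,\dots,Y_k\}$ of subsets of $E$, the sum diversity is $d_{\mathrm{sum}}(\mathcal Y) = \sum_{1 \le i < j \le k} d_w(Y_i, Y_j)$. \textsc{Max-Sum Diverse Solutions}: given a finite set $E$, an integer $k$, a weight function $w$ on $E$, and a membership oracle for a family $\mathcal X \subseteq 2^E$ (sets in $\mathcal X$ are called feasible solutions), find $k$ distinct sets $Y_1,\dots,Y_k \in \mathcal X$ maximizing $d_{\mathrm{sum}}(\{Y_1,\dots,Y_k\})$. For $w'\colon E\to\mathbb R$, a top-$k$ enumeration algorithm for $(E,\mathcal X,w',k)$ is an algorithm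 that outputs $k$ feasible solutions $Y_1,\dots,Y_k \in \mathcal X$ such that $w'(X) \le w'(Y)$ for every $Y \in \{Y_1,\dots,Y_k\}$ and every $X \in \mathcal X \setminus \{Y_1,\dots,Y_k\}$. An $\alpha$-approximation algorithm ($0<\alpha\le 1$) for a maximization problem outputs, on every instance $I$, a solution of value at least $\alpha \cdot \mathrm{OPT}(I)$. A polynomial-time approximation scheme (PTAS) is an algorithm which, given an instance and any constant $\varepsilon>0$, outputs in polynomial time a solution of value at least $(1-\varepsilon)\mathrm{OPT}(I)$. *)

(* Defs.v *)
From HB Require Import structures.
From mathcomp Require Import all_boot all_order all_algebra.
From mathcomp Require Import reals exp.

Set Implicit Arguments.
Unset Strict Implicit.
Unset Printing Implicit Defensive.

Import Order.TTheory GRing.Theory Num.Theory.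
Local Open Scope ring_scope.

(* A presented set family (E, X): the ground set E is 'I_gsize, so that its
   elements can be handled by a machine.  Algorithms access X through a
   membership oracle; [tape] is a read-only random-access input carrying
   whatever further presentation of X is available (a graph, say).  A problem
   given by its membership oracle alone is the case where [tape] is
   constantly 0. *)
Record setfamily := SetFamily {
  gsize : nat;
  feasible : {set {set 'I_gsize}};
  tape : nat -> nat }.

(* The model of computation is a structured real RAM.  Cells hold naturals,
   exact real numbers, or immutable ordered pairs; reals admit field operations
   and comparison, but neither rounding nor constants other than the images of
   naturals.  Unit-cost products of naturals are excluded, as usual for
   unbounded unit-cost registers. *)

Inductive value (R : Type) :=
  | VNat of nat
  | VReal of R
  | VPair of value R & value R.
Arguments VNat {R}.
Arguments VPair {R}.

Inductive unop := Fst | Snd | IsPair | RealOfNat.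

Inductive binop :=
  | AddN | SubN | LeN
  | AddR | SubR | MulR | DivR | LeR
  | MkPair.

(* [Read e] reads the cell whose address is the value of [e]; [Member e] is a
   query to the membership oracle; [Tape e] reads the input tape. *)
Inductive expr :=
  | Const of nat
  | Read of expr
  | Un of unop & expr
  | Bin of binop & expr & expr
  | Member of expr
  | Tape of expr.

(* [Call x c e] runs [c] in a fresh private memory that contains only the value
   of [e], at address 0, and stores in cell [x] what [c] leaves at address 0. *)
Inductive cmd :=
  | Skip
  | Write of expr & expr
  | Seq of cmd & cmd
  | If of expr & cmd & cmd
  | While of expr & cmd
  | Call of nat & cmd & expr.

Definition mem_of (R : Type) := nat -> value R.

Definition init_mem (R : Type) (v : value R) : mem_of R :=
  fun a => if a == 0%N then v else VNat 0.

Definition upd (R : Type) (m : mem_of R) (a : nat) (v : value R) : mem_of R :=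
  fun b => if b == a then v else m b.

Definition addr (R : Type) (v : value R) : nat := if v is VNat a then a else 0%N.

Definition truthy (R : Type) (v : value R) : bool :=
  if v is VNat a then (0 < a)%N else false.

(* Lists are right-nested pairs ended by [VNat 0]. *)
Definition enc_seq (R : Type) (s : seq (value R)) : value R :=
  foldr VPair (VNat 0) s.

Fixpoint dec_seq (R : Type) (v : value R) : seq (value R) :=
  if v is VPair a b then a :: dec_seq b else [::].

(* A subset of E is the list of the |E| bits of its characteristic vector. *)
Definition enc_set (R : Type) (n : nat) (X : {set 'I_n}) : value R :=
  enc_seq [seq VNat (i \in X : nat) | i <- enum 'I_n].

Definition dec_set (R : Type) (n : nat) (v : value R) : {set 'I_n} :=
  [set i : 'I_n | truthy (nth (VNat 0) (dec_seq v) i)].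

Definition enc_sets (R : Type) (n : nat) (Ys : seq {set 'I_n}) : value R :=
  enc_seq [seq enc_set R Y | Y <- Ys].

Definition enc_weight (R : Type) (n : nat) (w : 'I_n -> R) : value R :=
  enc_seq [seq VReal (w i) | i <- enum 'I_n].

(* Ill-typed operations return [VNat 0]; division by zero follows the library
   convention and returns 0. *)
Definition eval_un (R : realType) (o : unop) (v : value R) : value R :=
  match o, v with
  | Fst, VPair a _ => a
  | Snd, VPair _ b => b
  | IsPair, VPair _ _ => VNat 1
  | RealOfNat, VNat a => VReal a%:R
  | _, _ => VNat 0
  end.

Definition eval_bin (R : realType) (o : binop) (u v : value R) : value R :=
  match o, u, v with
  | AddN, VNat a, VNat b => VNat (a + b)
  | SubN, VNat a, VNat b => VNat (a - b)
  | LeN, VNat a, VNat b => VNat (a <= b)%N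
  | AddR, VReal x, VReal y => VReal (x + y)
  | SubR, VReal x, VReal y => VReal (x - y)
  | MulR, VReal x, VReal y => VReal (x * y)
  | DivR, VReal x, VReal y => VReal (x / y)
  | LeR, VReal x, VReal y => VNat (x <= y)%R
  | MkPair, a, b => VPair a b
  | _, _, _ => VNat 0
  end.

Fixpoint eval (R : realType) (F : setfamily) (m : mem_of R) (e : expr) : value R :=
  match e with
  | Const a => VNat a
  | Read e1 => m (addr (eval F m e1))
  | Un o e1 => eval_un o (eval F m e1)
  | Bin o e1 e2 => eval_bin o (eval F m e1) (eval F m e2)
  | Member e1 => VNat (dec_set (gsize F) (eval F m e1) \in feasible F)
  | Tape e1 => VNat (tape F (addr (eval F m e1)))
  end.

Fixpoint ecost (e : expr) : nat :=
  match e with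
  | Const _ => 1
  | Read e1 | Un _ e1 | Member e1 | Tape e1 => (ecost e1).+1
  | Bin _ e1 e2 => (ecost e1 + ecost e2).+1
  end.

(* [exec F c m m' t]: on the family F, the command c started in memory m halts
   in memory m' after t elementary steps. *)
Inductive exec (R : realType) (F : setfamily) :
    cmd -> mem_of R -> mem_of R -> nat -> Prop :=
  | exec_skip m : exec F Skip m m 1
  | exec_write m a e :
      exec F (Write a e) m (upd m (addr (eval F m a)) (eval F m e))
        (ecost a + ecost e).+1
  | exec_seq c1 c2 m m1 m2 t1 t2 :
      exec F c1 m m1 t1 -> exec F c2 m1 m2 t2 ->
      exec F (Seq c1 c2) m m2 (t1 + t2)
  | exec_if e c1 c2 m m1 t :
      exec F (if truthy (eval F m e) then c1 else c2) m m1 t ->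
      exec F (If e c1 c2) m m1 (ecost e + t).+1
  | exec_while_end e c m :
      ~~ truthy (eval F m e) -> exec F (While e c) m m (ecost e).+1
  | exec_while_step e c m m1 m2 t1 t2 :
      truthy (eval F m e) ->
      exec F c m m1 t1 -> exec F (While e c) m1 m2 t2 ->
      exec F (While e c) m m2 (ecost e + t1 + t2).+1
  | exec_call x c e m m1 t :
      exec F c (init_mem (eval F m e)) m1 t ->
      exec F (Call x c e) m (upd m x (m1 0%N)) (ecost e + t).+1.

Definition outputs (R : realType) (F : setfamily) (P : cmd) (vin vout : value R)
    (t : nat) : Prop :=
  exists m : mem_of R, exec F P (init_mem vin) m t /\ m 0%N = vout.

Definition wsum (R : realType) (n : nat) (w : 'I_n -> R) (Z : {set 'I_n}) : R :=
  \sum_(i in Z) w i.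

Definition symdiff (n : nat) (X Y : {set 'I_n}) : {set 'I_n} :=
  (X :\: Y) :|: (Y :\: X).

Definition dw (R : realType) (n : nat) (w : 'I_n -> R) (X Y : {set 'I_n}) : R :=
  wsum w (symdiff X Y).

Definition dsum (R : realType) (n k : nat) (w : 'I_n -> R)
    (Ys : k.-tuple {set 'I_n}) : R :=
  \sum_(i < k) \sum_(j < k | (i < j)%N) dw w (tnth Ys i) (tnth Ys j).

Definition is_solution (F : setfamily) (k : nat)
    (Ys : k.-tuple {set 'I_(gsize F)}) : bool :=
  uniq Ys && all (fun Y => Y \in feasible F) Ys.

(* The default value 0 of the maximum is harmless: weights are nonnegative and
   this is only used when k <= #|feasible F|, so that solutions exist. *)
Definition opt (R : realType) (F : setfamily) (w : 'I_(gsize F) -> R) (k : nat) : R :=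
  \big[Num.max/0]_(Ys : k.-tuple {set 'I_(gsize F)} | is_solution Ys) dsum w Ys.

Definition is_top (R : realType) (F : setfamily) (w : 'I_(gsize F) -> R) (k : nat)
    (Ys : k.-tuple {set 'I_(gsize F)}) : Prop :=
  is_solution Ys /\
  forall X Y : {set 'I_(gsize F)},
    X \in feasible F -> X \notin Ys -> Y \in Ys -> wsum w X <= wsum w Y.

Definition enc_instance (R : realType) (F : setfamily) (w : 'I_(gsize F) -> R)
    (k : nat) : value R :=
  VPair (VNat (gsize F)) (VPair (VNat k) (enc_weight w)).

(* Both problems ask for k distinct feasible sets, so k ranges over
   1, ..., #|feasible F|. *)
Definition valid_k (F : setfamily) (k : nat) : Prop :=
  (0 < k)%N /\ (k <= #|feasible F|)%N.

(* For a single finite E a bound O((|E| + k)^c) says nothing, so algorithms and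
   bounds are uniform over a class [cls] of set families: one program handles
   all families of the class, all weights and all k, within T |E| k steps. *)
Definition solves_topk (R : realType) (cls : setfamily -> Prop) (P : cmd)
    (T : nat -> nat -> R) : Prop :=
  forall (F : setfamily) (w' : 'I_(gsize F) -> R) (k : nat),
    cls F -> valid_k F k ->
    exists (Ys : k.-tuple {set 'I_(gsize F)}) (t : nat),
      [/\ outputs F P (enc_instance w' k) (enc_sets R Ys) t,
          is_top w' Ys
        & t%:R <= T (gsize F) k].

Definition approximates_on (R : realType) (F : setfamily) (w : 'I_(gsize F) -> R)
    (k : nat) (P : cmd) (vin : value R) (rho T : R) : Prop :=
  exists (Ys : k.-tuple {set 'I_(gsize F)}) (t : nat),
    [/\ outputs F P vin (enc_sets R Ys) t,
        is_solution Ys,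
        rho * opt w k <= dsum w Ys
      & t%:R <= T].

Definition solves_exactly_on (R : realType) (F : setfamily)
    (w : 'I_(gsize F) -> R) (k : nat) (P : cmd) (T : R) : Prop :=
  exists (Ys : k.-tuple {set 'I_(gsize F)}) (t : nat),
    [/\ outputs F P (enc_instance w k) (enc_sets R Ys) t,
        is_solution Ys,
        dsum w Ys = opt w k
      & t%:R <= T].

Definition approximates (R : realType) (cls : setfamily -> Prop) (P : cmd)
    (rho : nat -> R) (T : nat -> nat -> R) : Prop :=
  forall (F : setfamily) (w : 'I_(gsize F) -> R) (k : nat),
    cls F -> (forall i, 0 < w i) -> valid_k F k ->
    approximates_on w k P (enc_instance w k) (rho k) (T (gsize F) k).

Definition approx_ratio (R : realType) (k : nat) : R :=
  Num.max (1 - 2 / k%:R) (1 / 2).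

Definition topk_time (R : realType) (c : R) (n k : nat) : R :=
  (n + k)%:R `^ c.

(* (n + k)^c n k^2 log k, with the factors n and log k replaced by 1 when they
   are smaller, since they vanish for n = 0 and for k = 1.  When k >= 2 (hence
   n >= 1) this only changes the bound by a constant factor. *)
Definition approx_time (R : realType) (c : R) (n k : nat) : R :=
  (n + k)%:R `^ c * (maxn 1 n)%:R * k%:R ^+ 2 * Num.max 1 (ln k%:R).

Definition poly_time (R : realType) (C : R) (d : nat) (n k : nat) : R :=
  C * (n + k)%:R ^+ d.

Definition solves_exactly_at (R : realType) (cls : setfamily -> Prop) (P : cmd)
    (k : nat) : Prop :=
  exists (C : R) (d : nat),
    forall (F : setfamily) (w : 'I_(gsize F) -> R),
      cls F -> (forall i, 0 < w i) -> valid_k F k ->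
      solves_exactly_on w k P (poly_time C d (gsize F) k).

(* "A polynomial-time exact algorithm whenever k is a constant" can mean one
   algorithm whose running time is polynomial for each fixed k
   ([exact_uniform]), or a separate polynomial-time algorithm for each fixed k
   ([exact_each]).  They lead to the corresponding notions of PTAS: one
   algorithm that takes eps as part of its input ([ptas_uniform]), or one
   algorithm for each eps ([ptas_each]). *)
Definition exact_uniform (R : realType) (cls : setfamily -> Prop) : Prop :=
  exists P : cmd, forall k : nat, solves_exactly_at R cls P k.

Definition exact_each (R : realType) (cls : setfamily -> Prop) : Prop :=
  forall k : nat, exists P : cmd, solves_exactly_at R cls P k.

Definition ptas_uniform (R : realType) (cls : setfamily -> Prop) : Prop :=
  exists P : cmd, forall eps : R, 0 < eps ->
  exists (C : R) (d : nat),
    forall (F : setfamily) (w : 'I_(gsize F) -> R) (k : nat),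
      cls F -> (forall i, 0 < w i) -> valid_k F k ->
      approximates_on w k P (VPair (VReal eps) (enc_instance w k)) (1 - eps)
        (poly_time C d (gsize F) k).

Definition ptas_each (R : realType) (cls : setfamily -> Prop) : Prop :=
  forall eps : R, 0 < eps ->
  exists (P : cmd) (C : R) (d : nat),
    approximates cls P (fun _ => 1 - eps) (poly_time C d).

(* Main.v *)
Require Import Defs.
From mathcomp Require Import all_boot all_order all_algebra.
From mathcomp Require Import boolp reals exp.
From mathcomp Require Import zify ring lra.

Set Implicit Arguments.
Unset Strict Implicit.
Unset Printing Implicit Defensive.

Import Order.TTheory GRing.Theory Num.Theory.

(* A greedy start followed by local search.  For a fixed list A, the distance
   from X to A is, up to a constant, a linear function of X, so a best set to
   add to A is found by enumerating the top k feasible sets for suitable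
   weights.

   Write f for the sum diversity and let B be an optimal solution.  Since the
   weighted Hamming distance is a metric of negative type, averaging over the
   swaps of a member of A for a member of B shows that the best swap gains at
   least ((k-1) f(B) - (k+1) f(A)) / k^2.  Hence k steps at least halve the gap
   (k-1) f(B) - (k+1) f(A), and after O(k log k) steps it is at most
   (k-1) f(B) / k^2, which gives the ratio (1 - 1/k)^2 >= 1 - 2/k.  The greedy
   start gives 1/2 for k <= 3, where 1/2 is the larger ratio.

   A step makes k enumerations and spends O(n k) extra time on each.  That is
   within the time bound because the enumeration itself takes time at least
   (n + k) / 4, just to write its output. *)

(** * Programs and subroutines *)

Section WeakestPrecondition.
Variables (R : realType) (F : setfamily).
Implicit Types (m : mem_of R) (Q : mem_of R -> nat -> Prop) (s : seq (value R)).

(** Total correctness with time: the postcondition also sees the number of steps, so costs add up as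
    the rules are applied. *)
Definition wp c m Q := exists m' t, exec F c m m' t /\ Q m' t.

Lemma wp_mono c m Q Q' :
  wp c m Q -> (forall m' t, Q m' t -> Q' m' t) -> wp c m Q'.
Proof. by move=> [m' [t [ex Qm]]] QQ'; exists m', t; split=> //; apply: QQ'. Qed.

Lemma wp_skip m Q : Q m 1 -> wp Skip m Q.
Proof. by move=> Qm; exists m, 1; split=> //; constructor. Qed.

Lemma wp_write a e m Q :
  Q (upd m (addr (eval F m a)) (eval F m e)) (ecost a + ecost e).+1 ->
  wp (Write a e) m Q.
Proof. by move=> Qm; do 2!eexists; split; [constructor | exact: Qm]. Qed.

Lemma wp_seq c1 c2 m Q :
  wp c1 m (fun m1 t1 => wp c2 m1 (fun m2 t2 => Q m2 (t1 + t2))) ->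
  wp (Seq c1 c2) m Q.
Proof.
move=> [m1 [t1 [ex1 [m2 [t2 [ex2 Qm]]]]]].
by exists m2, (t1 + t2); split=> //; apply: exec_seq ex1 ex2.
Qed.

Lemma wp_if e c1 c2 m Q :
  wp (if truthy (eval F m e) then c1 else c2) m (fun m1 t => Q m1 (ecost e + t).+1) ->
  wp (If e c1 c2) m Q.
Proof. by move=> [m1 [t [ex Qm]]]; do 2!eexists; split; [apply: exec_if ex | exact: Qm]. Qed.

Lemma wp_call x c e m Q :
  wp c (init_mem (eval F m e)) (fun m1 t => Q (upd m x (m1 0)) (ecost e + t).+1) ->
  wp (Call x c e) m Q.
Proof. by move=> [m1 [t [ex Qm]]]; do 2!eexists; split; [apply: exec_call ex | exact: Qm]. Qed.

(** The invariant is indexed by the number of iterations left, which gives termination; as [B]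
    bounds each run of the body, the same index gives the time. *)
Lemma wp_while (Inv : nat -> mem_of R -> Prop) B j e c m Q :
    Inv j m ->
    (forall i m1, Inv i.+1 m1 ->
       truthy (eval F m1 e) /\ wp c m1 (fun m2 t => Inv i m2 /\ t <= B)) ->
    (forall m1, Inv 0 m1 -> ~~ truthy (eval F m1 e)) ->
    (forall m1 t, Inv 0 m1 -> t <= j * (B + (ecost e).+1) + (ecost e).+1 -> Q m1 t) ->
  wp (While e c) m Q.
Proof.
move=> Im step stop; elim: j m Im Q => [|j IHj] m Im Q QQ.
  exists m, (ecost e).+1; split; first by constructor; apply: stop.
  by apply: QQ => //; rewrite mul0n.
have [tm [m1 [t1 [ex1 [Im1 t1B]]]]] := step _ _ Im.
have [m2 [t2 [ex2 [Im2 t2B]]]] := IHj _ Im1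
  (fun m2 t => Inv 0 m2 /\ t <= j * (B + (ecost e).+1) + (ecost e).+1) (fun _ _ p q => conj p q).
exists m2, (ecost e + t1 + t2).+1; split; first by apply: exec_while_step ex1 ex2.
by apply: QQ => //; rewrite mulSn; lia.
Qed.

(* The cells [0 .. size s - 1] are the program variables. *)
Fixpoint memx s (M : mem_of R) (a : nat) : value R :=
  if s is v :: s' then if a is a'.+1 then memx s' M a' else v else M a.

Definition mem0 : mem_of R := fun _ => VNat 0.

Lemma memx_init r v : init_mem v = memx (v :: nseq r (VNat 0)) mem0.
Proof.
apply: funext => -[|a] //=; rewrite /init_mem /=.
by elim: r a => [|r IHr] [|a] //=.
Qed.

Lemma upd_memx s M i v : i < size s ->
  upd (memx s M) i v = memx (set_nth (VNat 0) s i v) M.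
Proof.
move=> lis; apply: funext; elim: s i lis => [|u s IHs] [|i] //= lis [|a] //=.
by rewrite -IHs // /upd.
Qed.

(** Cells beyond the variables serve as scratch memory, for instance for a table of marks. *)
Lemma upd_memx_size s M i v :
  upd (memx s M) (size s + i) v = memx s (upd M i v).
Proof.
apply: funext; elim: s => [|u s IHs] //= [|a] //=.
by rewrite -IHs // /upd.
Qed.

Lemma wp_set i e s M Q : i < size s ->
  Q (memx (set_nth (VNat 0) s i (eval F (memx s M) e)) M) (ecost e).+2 ->
  wp (Write (Const i) e) (memx s M) Q.
Proof. by move=> lis Qm; apply: wp_write; rewrite /= add1n upd_memx. Qed.

Definition computes c (v : value R) (Post : value R -> Prop) (T : nat) :=
  wp c (init_mem v) (fun m t => Post (m 0) /\ t <= T).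

Lemma wp_sub c Post T x e s M Q : computes c (eval F (memx s M) e) Post T ->
    x < size s ->
    (forall u t, Post u -> t <= T ->
       Q (memx (set_nth (VNat 0) s x u) M) (ecost e + t).+1) ->
  wp (Call x c e) (memx s M) Q.
Proof.
move=> comp lxs QQ; apply: wp_call; apply: wp_mono comp _ => m t [Pm tT].
by rewrite upd_memx //; apply: QQ.
Qed.

Lemma computesP c v Post T r :
  wp c (memx (v :: nseq r (VNat 0)) mem0) (fun m t => Post (m 0) /\ t <= T) ->
  computes c v Post T.
Proof. by rewrite /computes (memx_init r). Qed.

End WeakestPrecondition.

Arguments wp_while {R F}.
Arguments memx {R} !s M !a.

Definition var i := Read (Const i).
Definition efst e := Un Fst e.
Definition esnd e := Un Snd e.
Definition epair e1 e2 := Bin MkPair e1 e2.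
Definition nonempty e := Un IsPair e.

Fixpoint block cs := if cs is c :: cs' then Seq c (block cs') else Skip.

Ltac wp_step :=
  lazymatch goal with
  | |- wp _ (block _) _ _ => rewrite /block
  | |- wp _ (Seq _ _) _ _ => apply: wp_seq
  | |- wp _ (Write (Const _) _) (memx _ _) _ => apply: wp_set; [by []|]; rewrite /=
  | |- wp _ Skip _ _ => apply: wp_skip
  end.
Ltac wp_callee H := eapply wp_sub; [exact: H | by [] | rewrite /=].
Ltac wp_steps := repeat wp_step.

(** * Subroutines on lists, weights and sets *)

Section Subroutines.
Variables (R : realType) (F : setfamily).
Local Notation value := (value R).
Local Notation mem0 := (@mem0 R).

Definition catrev_cmd := block [::
  Write (Const 1) (efst (var 0)); Write (Const 2) (esnd (var 0));
  While (nonempty (var 1)) (block [::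
    Write (Const 2) (epair (efst (var 1)) (var 2));
    Write (Const 1) (esnd (var 1))]);
  Write (Const 0) (var 2)].

Lemma catrev_cmdP (l l' : seq value) :
  computes F catrev_cmd (VPair (enc_seq l) (enc_seq l'))
    (fun u => u = enc_seq (catrev l l')) (25 * (size l).+1).
Proof.
apply: (@computesP _ _ _ _ _ _ 2); rewrite /catrev_cmd /=; wp_steps.
apply: (@wp_while _ _ (fun j m => exists v0 p q, [/\ size p = j, catrev p q = catrev l l' &
    m = memx [:: v0; enc_seq p; enc_seq q] mem0]) 20 (size l)).
- by exists (VPair (enc_seq l) (enc_seq l')), l, l'.
- move=> i _ [v0 [[|x p] [q [//= [sp] pq ->]]]]; split=> //; wp_steps.
  by split=> //; exists v0, p, (x :: q).
- by move=> _ [v0 [[|x p] [q [//= _ _ ->]]]].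
move=> m1 t [v0 [[|x p] [q [//= _ /= -> ->]]]] tB; wp_steps; split=> //.
by move: tB; rewrite /=; lia.
Qed.

Definition enc_reals T (g : T -> R) (s : seq T) : value :=
  enc_seq [seq VReal (g i) | i <- s].
Definition enc_bits T (b : T -> bool) (s : seq T) : value :=
  enc_seq [seq VNat (b i : nat) | i <- s].

Definition zeros_cmd := block [::
  While (nonempty (var 0)) (block [::
    Write (Const 1) (epair (Un RealOfNat (Const 0)) (var 1));
    Write (Const 0) (esnd (var 0))]);
  Write (Const 0) (var 1)].

Lemma zeros_cmdP T (w : T -> R) (s : seq T) :
  computes F zeros_cmd (enc_reals w s)
    (fun u => u = enc_reals (fun=> 0%R) s) (25 * (size s).+1).
Proof.
apply: (@computesP _ _ _ _ _ _ 1); rewrite /zeros_cmd /=; wp_steps.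
apply: (@wp_while _ _ (fun j m => exists p q : seq T, [/\ size q = j, size p + size q = size s &
    m = memx [:: enc_reals w q; enc_reals (fun=> 0%R) p] mem0]) 20 (size s)).
- by exists [::], s.
- move=> i _ [p [[|x q] [//= [sp] pq ->]]]; split=> //; wp_steps.
  by split=> //; exists (x :: p), q; split=> //=; rewrite addSnnS.
- by move=> _ [p [[|x q] [//= _ _ ->]]].
move=> m1 t [p [[|x q] [//= _ ps ->]]] tB; wp_steps; split=> //=; last first.
  by move: tB; rewrite /=; lia.
(* A list of zeros depends only on its length, so its reversed construction is harmless. *)
rewrite addn0 in ps; rewrite /enc_reals; congr enc_seq.
by elim: (p) (s) ps => [|y p' IHp] [|z s'] //= [/IHp ->].
Qed.

Definition addset_cmd := block [::
  Write (Const 1) (efst (var 0));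
  Write (Const 2) (efst (esnd (var 0))); Write (Const 3) (esnd (esnd (var 0)));
  While (nonempty (var 1)) (block [::
    Write (Const 4) (epair
      (Bin AddR (efst (var 1)) (Bin SubR (efst (var 2))
        (Bin MulR (Bin AddR (efst (var 2)) (efst (var 2)))
           (Un RealOfNat (efst (var 3))))))
      (var 4));
    Write (Const 1) (esnd (var 1));
    Write (Const 2) (esnd (var 2));
    Write (Const 3) (esnd (var 3))]);
  Call 0 catrev_cmd (epair (var 4) (Const 0))].

(** An element outside the set contributes [w i], one inside contributes [- w i]: the share of one
    member in [dweight]. *)
Lemma addset_cmdP T (g w : T -> R) (b : T -> bool) (s : seq T) :
  computes F addset_cmd (VPair (enc_reals g s) (VPair (enc_reals w s) (enc_bits b s)))
    (fun u => u = enc_reals (fun i => g i + (w i - (w i + w i) * (b i)%:R))%R s)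
    (90 * (size s).+1).
Proof.
apply: (@computesP _ _ _ _ _ _ 4); rewrite /addset_cmd /=; wp_steps.
set h := fun i => (g i + (w i - (w i + w i) * (b i)%:R))%R.
apply: (@wp_while _ _ (fun j m => exists v0 p q, [/\ size q = j, catrev p q = s &
    m = memx [:: v0; enc_reals g q; enc_reals w q; enc_bits b q; enc_reals h p] mem0])
  50 (size s)).
- by eexists _, [::], s.
- move=> i _ [v0 [p [[|x q] [//= [sp] pq ->]]]]; split=> //; wp_steps.
  by split=> //; exists v0, (x :: p), q.
- by move=> _ [v0 [p [[|x q] [//= _ _ ->]]]].
move=> m1 t [v0 [p [[|x q] [//= _ ps ->]]]] tB; wp_steps.
wp_callee (catrev_cmdP [seq VReal (h i) | i <- p] [::]) => u t' -> tB'.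
wp_steps; split=> //=; first by rewrite catrevE cats0 -map_rev -ps catrevE cats0.
have sp : size p = size s by rewrite -ps catrevE cats0 size_rev.
by rewrite size_map sp in tB'; move: tB => /=; lia.
Qed.

Section Sets.
Variable n : nat.
Implicit Types (w : 'I_n -> R) (X Y : {set 'I_n}) (A : seq {set 'I_n}).

(* Up to the constant [\sum_(Y <- A) wsum w Y], the total distance from X to
   the members of A is the sum of these weights over X. *)
Definition dweight w A (i : 'I_n) : R :=
  (\sum_(Y <- A) (w i - (w i + w i) * (i \in Y)%:R))%R.

Definition dweight_cmd := block [::
  Call 1 zeros_cmd (efst (var 0));
  Write (Const 2) (esnd (var 0));
  While (nonempty (var 2)) (block [::
    Call 1 addset_cmd (epair (var 1) (epair (efst (var 0)) (efst (var 2))));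
    Write (Const 2) (esnd (var 2))]);
  Write (Const 0) (var 1)].

Lemma dweight_cmdP w A :
  computes F dweight_cmd (VPair (enc_weight w) (enc_sets R A))
    (fun u => u = enc_weight (dweight w A)) (150 * (n.+1 * (size A).+1)).
Proof.
apply: (@computesP _ _ _ _ _ _ 2); rewrite /dweight_cmd /=; wp_steps.
wp_callee (zeros_cmdP w (enum 'I_n)) => _ t0 -> t0B; wp_steps.
apply: (@wp_while _ _ (fun j m => exists p q, [/\ size q = j, catrev p q = A &
    m = memx [:: VPair (enc_weight w) (enc_sets R A);
                 enc_weight (dweight w p); enc_sets R q] mem0])
  (90 * n.+1 + 20) (size A)).
- exists [::], A; split=> //; congr memx; congr [:: _; enc_seq _; _].
  by apply: eq_map => i; rewrite /dweight big_nil.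
- move=> i _ [p [[|Y q] [//= [sp] pq ->]]]; split=> //; wp_steps.
  wp_callee (addset_cmdP (dweight w p) w (mem Y) (enum 'I_n)) => _ t -> tB; wp_steps.
  split; last by rewrite size_enum_ord in tB; lia.
  exists (Y :: p), q; split=> //; congr memx; congr [:: _; enc_seq _; _].
  by apply: eq_map => j; rewrite /dweight big_cons addrC.
- by move=> _ [p [[|Y q] [//= _ _ ->]]].
move=> m1 t [p [[|Y q] [//= _ ps ->]]] tB; wp_steps; split=> //=.
  congr enc_seq; apply: eq_map => i; congr VReal; apply: perm_big.
  by rewrite -ps catrevE cats0 perm_sym perm_rev.
rewrite size_enum_ord in t0B; move: tB => /=; nia.
Qed.

Definition score_cmd := block [::
  Write (Const 1) (efst (var 0));
  Write (Const 2) (esnd (var 0));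
  Write (Const 0) (Un RealOfNat (Const 0));
  While (nonempty (var 1)) (block [::
    Write (Const 0) (Bin AddR (var 0)
      (Bin MulR (efst (var 1)) (Un RealOfNat (efst (var 2)))));
    Write (Const 1) (esnd (var 1)); Write (Const 2) (esnd (var 2))])].

Lemma wsum_bits w X : wsum w X = (\sum_(i <- enum 'I_n) w i * (i \in X)%:R)%R.
Proof.
by rewrite /wsum big_mkcond big_enum; apply: eq_bigr => i _; case: ifP; rewrite (mulr1, mulr0).
Qed.

Lemma score_cmdP w X :
  computes F score_cmd (VPair (enc_weight w) (enc_set R X))
    (fun u => u = VReal (wsum w X)) (50 * n.+1).
Proof.
apply: (@computesP _ _ _ _ _ _ 2); rewrite /score_cmd /=; wp_steps.
pose S s : R := (\sum_(i <- s) w i * (i \in X)%:R)%R.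
apply: (@wp_while _ _ (fun j m => exists a q, [/\ size q = j, (a + S q)%R = wsum w X &
    m = memx [:: VReal a; enc_reals w q; enc_bits (mem X) q] mem0]) 40 n).
- exists 0%R, (enum 'I_n); split=> //; first by rewrite size_enum_ord.
  by rewrite wsum_bits add0r.
- move=> i _ [a [[|x q] [//= [sp] pq ->]]]; split=> //; wp_steps.
  split=> //; exists (a + w x * (x \in X)%:R)%R, q; split=> //.
  by rewrite -pq /S big_cons addrA.
- by move=> _ [a [[|x q] [//= _ _ ->]]].
move=> m1 t [a [[|x q] [//= _ ps ->]]] tB; wp_steps; split=> //=.
  by rewrite -ps /S big_nil addr0.
by move: tB => /=; lia.
Qed.

Definition push_bit (b : bool) a := a + a + b.

(** The characteristic vector read as a binary number. It serves as a memory address, so that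
    membership in a list of sets is tested by looking up a single cell. Doubling is done by
    addition, as products of naturals are excluded. *)
Definition set_key X := foldl (fun a i => push_bit (i \in X) a) 0 (enum 'I_n).

(** Recovering the starting values as well lets the induction go through: it yields the values after
    the first push, whose parity is the first bit. *)
Lemma push_bit_foldl_inj (s1 s2 : bitseq) a1 a2 : size s1 = size s2 ->
  foldl (fun a b => push_bit b a) a1 s1 = foldl (fun a b => push_bit b a) a2 s2 ->
  a1 = a2 /\ s1 = s2.
Proof.
elim: s1 s2 a1 a2 => [|b1 s1 IHs] [|b2 s2] a1 a2 //= [/IHs IH] /IH [].
by rewrite /push_bit => + ->; case: b1; case: b2 => /= eqa; split=> //; lia.
Qed.

Lemma set_key_inj : injective set_key.
Proof.
move=> X Y; rewrite /set_key.
have E Z a s : foldl (fun a i => push_bit (i \in Z) a) a s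
    = foldl (fun a b => push_bit b a) a [seq i \in Z | i <- s].
  by elim: s a => //= i s IHs a; rewrite IHs.
rewrite !E => /push_bit_foldl_inj [|_ /eq_in_map XY]; first by rewrite !size_map.
by apply/setP => i; apply: XY; rewrite mem_enum.
Qed.

Definition key_cmd := block [::
  While (nonempty (var 0)) (block [::
    Write (Const 1) (Bin AddN (Bin AddN (var 1) (var 1)) (efst (var 0)));
    Write (Const 0) (esnd (var 0))]);
  Write (Const 0) (var 1)].

Lemma key_cmdP X :
  computes F key_cmd (enc_set R X) (fun u => u = VNat (set_key X)) (40 * n.+1).
Proof.
apply: (@computesP _ _ _ _ _ _ 1); rewrite /key_cmd /=; wp_steps.
apply: (@wp_while _ _ (fun j m => exists a q, [/\ size q = j,
    foldl (fun a i => push_bit (i \in X) a) a q = set_key X &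
    m = memx [:: enc_bits (mem X) q; VNat a] mem0]) 30 n).
- by exists 0, (enum 'I_n); split=> //; rewrite size_enum_ord.
- move=> i _ [a [[|x q] [//= [sp] pq ->]]]; split=> //; wp_steps.
  by split=> //; exists (push_bit (x \in X) a), q.
- by move=> _ [a [[|x q] [//= _ _ ->]]].
move=> m1 t [a [[|x q] [//= _ -> ->]]] tB; wp_steps; split=> //=.
by move: tB => /=; lia.
Qed.

End Sets.
End Subroutines.

(** * Diversity as a dispersion of negative type *)

Section Dispersion.
Variables (R : realType) (n : nat) (w : 'I_n -> R).
Hypothesis w_ge0 : forall i, (0 <= w i)%R.
Local Open Scope ring_scope.
Implicit Types (X Y Z : {set 'I_n}) (A B C : seq {set 'I_n}).
Local Notation d := (dw w).

Lemma natr_bool (b : bool) : (b%:R : R) = if b then 1 else 0.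
Proof. by case: b. Qed.

(** The indicator of a symmetric difference is [x + y - 2xy], so claims about distances reduce to
    one element at a time. *)
Lemma dwE X Y : d X Y =
  \sum_i w i * ((i \in X)%:R + (i \in Y)%:R - 2 * (i \in X)%:R * (i \in Y)%:R).
Proof.
rewrite /dw /wsum big_mkcond; apply: eq_bigr => i _; rewrite !inE !natr_bool.
by do 2!case: (i \in _) => /=; ring.
Qed.

Lemma dw_sym X Y : d X Y = d Y X.
Proof. by rewrite !dwE; apply: eq_bigr => i _; ring. Qed.

Lemma dw_self X : d X X = 0.
Proof. by rewrite dwE big1 // => i _; rewrite natr_bool; case: (i \in X); ring. Qed.

Lemma dw_ge0 X Y : 0 <= d X Y.
Proof. by apply: sumr_ge0 => i _. Qed.

Lemma dw_triangle X Y Z : d X Z <= d X Y + d Y Z.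
Proof.
rewrite !dwE -big_split; apply: ler_sum => i _ /=; rewrite -mulrDr ler_wpM2l // !natr_bool.
by do 3!case: (i \in _); lra.
Qed.

Definition dist_to X A := \sum_(Y <- A) d X Y.

(** Sums over ordered pairs: [cross A A] is twice the sum diversity, and bilinearity replaces the
    handling of indices. *)
Definition cross A B := \sum_(X <- A) dist_to X B.

Lemma dist_toE X A :
  dist_to X A = wsum (dweight w A) X + \sum_(Y <- A) wsum w Y.
Proof.
rewrite /dist_to /wsum /dweight exchange_big -big_split; apply: eq_bigr => Y _ /=.
rewrite dwE (big_mkcond (mem X)) (big_mkcond (mem Y)) -big_split; apply: eq_bigr => i _ /=.
by rewrite !natr_bool; do 2!case: (i \in _); ring.
Qed.

Lemma dist_to_cons X Y A : dist_to X (Y :: A) = d X Y + dist_to X A.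
Proof. by rewrite /dist_to big_cons. Qed.

Lemma dist_to_ge0 X A : 0 <= dist_to X A.
Proof. by apply: sumr_ge0 => Y _; apply: dw_ge0. Qed.

Lemma dist_to_perm X A B : perm_eq A B -> dist_to X A = dist_to X B.
Proof. exact: perm_big. Qed.

Lemma cross_sym A B : cross A B = cross B A.
Proof.
rewrite /cross /dist_to exchange_big; apply: eq_bigr => X _; apply: eq_bigr => Y _.
exact: dw_sym.
Qed.

Lemma cross_ge0 A B : 0 <= cross A B.
Proof. by apply: sumr_ge0 => X _; apply: dist_to_ge0. Qed.

Lemma cross_permr A B C : perm_eq B C -> cross A B = cross A C.
Proof. by move=> BC; apply: eq_bigr => X _; apply: dist_to_perm. Qed.

Lemma cross_perm A B : perm_eq A B -> cross A A = cross B B.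
Proof. by move=> AB; rewrite (cross_permr _ AB) cross_sym (cross_permr _ AB). Qed.

Lemma cross_catr A B C : cross A (B ++ C) = cross A B + cross A C.
Proof. by rewrite /cross -big_split; apply: eq_bigr => X _; rewrite /dist_to big_cat. Qed.

Lemma cross_catl A B C : cross (B ++ C) A = cross B A + cross C A.
Proof. by rewrite cross_sym cross_catr !(cross_sym A). Qed.

Lemma cross_consl X A B : cross (X :: A) B = dist_to X B + cross A B.
Proof. by rewrite /cross big_cons. Qed.

Lemma cross_cons X A : cross (X :: A) (X :: A) = cross A A + 2 * dist_to X A.
Proof.
rewrite cross_consl dist_to_cons dw_self cross_sym cross_consl; ring.
Qed.

(** If [a] members of [A] and [b] of [B] contain [i], then [i] separates [a (|B| - b) + b (|A| - a)]
    pairs. *)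
Lemma crossE A B : cross A B = \sum_i w i *
   ((size B)%:R * (\sum_(X <- A) (i \in X)%:R) + (size A)%:R * (\sum_(Y <- B) (i \in Y)%:R)
    - 2 * (\sum_(X <- A) (i \in X)%:R) * (\sum_(Y <- B) (i \in Y)%:R)).
Proof.
elim: A => [|X A IHA].
  rewrite /cross big_nil big1 // => i _; rewrite !big_nil /=; ring.
rewrite cross_consl {}IHA.
have -> : dist_to X B = \sum_i w i * ((size B)%:R * (i \in X)%:R
    + (\sum_(Y <- B) (i \in Y)%:R) - 2 * (i \in X)%:R * (\sum_(Y <- B) (i \in Y)%:R)).
  elim: B => [|Y B IHB].
    rewrite /dist_to big_nil big1 // => i _; rewrite !big_nil /=; ring.
  rewrite dist_to_cons {}IHB dwE -big_split; apply: eq_bigr => i _ /=.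
  rewrite !big_cons -natr1; ring.
rewrite -big_split; apply: eq_bigr => i _ /=; rewrite !big_cons -natr1; ring.
Qed.

(** At each element the difference of the two sides is [2 w(i) (p - q)^2], where [p] and [q] count
    the members containing it. *)
Lemma cross_negative_type A B : size A = size B ->
  cross A A + cross B B <= 2 * cross A B.
Proof.
move=> sAB; rewrite !crossE mulr_sumr -big_split; apply: ler_sum => i _ /=; rewrite sAB.
set p := \sum_(X <- A) _; set q := \sum_(X <- B) _; set k := _%:R.
rewrite -subr_ge0.
rewrite [leRHS](_ : _ = 2 * (w i * (p - q) ^+ 2)); last by ring.
by rewrite mulr_ge0 // mulr_ge0 ?sqr_ge0.
Qed.

Lemma dsum_cross k (Ys : k.-tuple {set 'I_n}) : 2 * dsum w Ys = cross Ys Ys.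
Proof.
rewrite /cross /dist_to big_tuple.
under eq_bigr do rewrite big_tuple.
transitivity (\sum_(i < k) (\sum_(j < k | (i < j)%N) d (tnth Ys i) (tnth Ys j)
    + \sum_(j < k | (j < i)%N) d (tnth Ys i) (tnth Ys j))).
  rewrite big_split /= -/(dsum w Ys); set s := \sum_(i < k) _.
  suff -> : s = dsum w Ys by ring.
  rewrite /s (exchange_big_dep xpredT) //=; apply: eq_bigr => i _.
  by apply: eq_bigr => j _; apply: dw_sym.
apply: eq_bigr => i _; rewrite [RHS](bigD1 i) //= dw_self add0r.
rewrite [RHS](bigID (fun j : 'I_k => (i < j)%N)) /=; congr (_ + _).
  by apply: eq_bigl => j; rewrite -val_eqE /=; case: ltngtP.
by apply: eq_bigl => j; rewrite -val_eqE /=; case: ltngtP.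
Qed.

Lemma sum_const_seq I (s : seq I) (x : R) : \sum_(i <- s) x = (size s)%:R * x.
Proof. by rewrite big_const_seq count_predT iter_addr addr0 mulr_natl. Qed.

(** Sum of the triangle inequality over all triples from [A], [B] and [C]. *)
Lemma cross_triangle A B C :
  (size C)%:R * cross A B <= (size B)%:R * cross A C + (size A)%:R * cross B C.
Proof.
elim: C => [|Z C IHC]; first by rewrite mul0r addr_ge0 // mulr_ge0 // cross_ge0.
have consr D : cross D (Z :: C) = dist_to Z D + cross D C.
  by rewrite cross_sym cross_consl (cross_sym C).
rewrite !consr; suff : cross A B <= (size B)%:R * dist_to Z A + (size A)%:R * dist_to Z B.
  by rewrite /= -natr1; nra.
have: cross A B <= \sum_(X <- A) \sum_(Y <- B) (d Z X + d Z Y).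
  apply: ler_sum => X _; apply: ler_sum => Y _.
  by rewrite (dw_sym Z X); apply: dw_triangle.
under eq_bigr do rewrite big_split /= sum_const_seq.
by rewrite big_split /= sum_const_seq -mulr_sumr.
Qed.

(** The gains are summed over all pairs from the differences [A1] and [B1]. Negative type compares
    the distances inside and between these differences, and the triangle inequality brings in the
    common part [C]. *)
Lemma cross_swap_bound A B g : uniq A -> uniq B -> size A = size B -> 0 <= g ->
  (forall X Y, X \in A -> Y \in B -> Y \notin rem X A ->
     2 * (dist_to Y (rem X A) - dist_to X (rem X A)) <= g) ->
  ((size A)%:R - 1) * cross B B - ((size A)%:R + 1) * cross A A <= (size A)%:R ^+ 2 * g.
Proof.
move=> uA uB sAB g0 gP.
pose C := [seq X <- A | X \in B].
pose A1 := [seq X <- A | X \notin B]; pose B1 := [seq Y <- B | Y \notin A].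
have pA : perm_eq (A1 ++ C) A by rewrite perm_catC; apply: permEl; apply: perm_filterC.
have pB : perm_eq (B1 ++ C) B.
  apply: uniq_perm => //.
    rewrite cat_uniq !filter_uniq //= andbT; apply/hasPn => X.
    by rewrite !mem_filter => /andP[_ ->].
  by move=> X; rewrite mem_cat !mem_filter; do 2!case: (X \in _).
have sA : (size A = size A1 + size C)%N by rewrite -(perm_size pA) size_cat.
have sB : (size B = size B1 + size C)%N by rewrite -(perm_size pB) size_cat.
have s1 : size A1 = size B1 by lia.
rewrite -(cross_perm pA) -(cross_perm pB).
(* Distances to [rem X A] are rewritten as distances to all of [A], which can be summed
   independently over [X] and [Y]. *)
have gA1 X Y : X \in A1 -> Y \in B1 -> 2 * (dist_to Y A - d X Y - dist_to X A) <= g.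
  rewrite !mem_filter => /andP[XB XA] /andP[YA YB].
  have := gP X Y XA YB; rewrite (contra (@mem_rem _ _ _ _) YA) => /(_ isT).
  rewrite !(dist_to_perm _ (perm_to_rem XA)) !dist_to_cons dw_self (dw_sym Y X); lra.
set m := size A1 in sA s1; set l := size C in sA sB.
have swaps : 2 * (m%:R * cross B1 A - cross A1 B1 - m%:R * cross A1 A) <= m%:R ^+ 2 * g.
  have: \sum_(X <- A1) \sum_(Y <- B1) 2 * (dist_to Y A - d X Y - dist_to X A)
      <= \sum_(X <- A1) \sum_(Y <- B1) g.
    rewrite !big_seq; apply: ler_sum => X XA1; rewrite !big_seq.
    by apply: ler_sum => Y YB1; apply: gA1.
  rewrite !sum_const_seq -/m -s1 mulrA -expr2; congr (_ <= _).
  under eq_bigr do rewrite -mulr_sumr !sumrB sum_const_seq -s1.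
  by rewrite -mulr_sumr !sumrB sum_const_seq -mulr_sumr.
have tri : l%:R * cross A1 B1 <= m%:R * (cross A1 C + cross B1 C).
  by rewrite mulrDr {2}s1; have := cross_triangle A1 B1 C; rewrite -s1.
have neg := cross_negative_type s1.
move: swaps; rewrite -!(cross_permr _ pA) !cross_catl !cross_catr.
rewrite (cross_sym C A1) (cross_sym C B1) (cross_sym B1 A1).
move: (cross_ge0 A1 A1) (cross_ge0 B1 B1) (cross_ge0 C C) (cross_ge0 A1 C) (cross_ge0 B1 C).
(* If [m = 0], the lists agree up to order and the left side is [-2 * cross C C]. *)
have [m0|m_gt0] := posnP m.
  have -> : A1 = [::] by apply: size0nil.
  have -> : B1 = [::] by apply: size0nil; rewrite -s1.
  rewrite /cross !big_nil; have : 0 <= (size A)%:R ^+ 2 * g by rewrite mulr_ge0 ?sqr_ge0.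
  nra.
move: tri neg; rewrite sA natrD.
set x := cross A1 A1; set y := cross B1 B1; set z := cross A1 B1; set u := cross A1 C.
set v := cross B1 C; set c := cross C C.
have M1 : (1 : R) <= m%:R by rewrite ler1n.
have L0 : (0 : R) <= l%:R by rewrite ler0n.
move: (m%:R) M1 (l%:R) L0 => M M1 L L0 tri neg x0 y0 c0 u0 v0 swaps.
have M0 : 0 < M by lra.
have K0 : 0 < M + L by lra.
have swaps' : 2 * ((z + v) - z / M - (x + u)) <= M * g.
  rewrite -(ler_pM2l M0); apply: le_trans (le_trans swaps _); last by rewrite expr2 mulrA.
  by rewrite le_eqVlt; apply/orP; left; apply/eqP; field; rewrite gt_eqF.
have tri' : (M + L) * (z / M) - z <= u + v.
  have -> : (M + L) * (z / M) - z = (L * z) / M by field; rewrite gt_eqF.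
  by rewrite ler_pdivrMr // [leRHS]mulrC.
have sg : M * g <= (M + L) * g by nra.
have {}swaps' : (M + L) * (2 * ((z + v) - z / M - (x + u))) <= (M + L) ^+ 2 * g.
  by rewrite expr2 -mulrA ler_pM2l //; apply: le_trans sg.
apply: le_trans swaps'.
(* With [k = M + L], the right side exceeds the left by [(k - 1) * (2 * z - x - y) + 2 * (u + v + z
   - k * (z / M)) + 2 * c]; the terms are nonnegative by negative type, the triangle inequality and
   [c0]. *)
have {}neg : (M + L - 1) * (x + y) <= (M + L - 1) * (2 * z) by rewrite ler_wpM2l //; lra.
move: tri'; move: (z / M) => q tri'.
lra.
Qed.

(** By [cross_swap_bound] the increase is at least a [1 / k^2] part of the gap; the gap falls by
    [k + 1] times the increase, hence by at least a [1 / k] part. *)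
Lemma cross_swap_gap A A' B e :
  uniq A -> uniq B -> size A = size B -> (0 < size A)%N ->
  cross A A <= cross A' A' ->
  (forall X Y, X \in A -> Y \in B -> Y \notin rem X A ->
     2 * (dist_to Y (rem X A) - dist_to X (rem X A)) <= cross A' A' - cross A A) ->
  0 <= e ->
  ((size A)%:R - 1) * cross B B - ((size A)%:R + 1) * cross A A <= e ->
  ((size A)%:R - 1) * cross B B - ((size A)%:R + 1) * cross A' A' <= (1 - (size A)%:R^-1) * e.
Proof.
move=> uA uB sAB A0 AA' gP e0.
have := cross_swap_bound uA uB sAB _ gP; rewrite subr_ge0 => /(_ AA').
have: (1 : R) <= (size A)%:R by rewrite ler1n.
move: (size A)%:R => k k1.
set D := cross A' A' - cross A A => step gap.
have D0 : 0 <= D by rewrite subr_ge0.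
have iv0 : 0 <= 1 - k^-1 by rewrite subr_ge0 invf_le1 //; lra.
have -> : cross A' A' = cross A A + D by rewrite /D; ring.
move: step gap; set G := _ - _ => step gap.
have -> : (k - 1) * cross B B - (k + 1) * (cross A A + D) = G - (k + 1) * D by rewrite /G; ring.
apply: le_trans (_ : Num.max 0 ((1 - k^-1) * G) <= _); last first.
  by rewrite ge_max mulr_ge0 //= ler_wpM2l.
have [G0|G0] := leP G 0; first by rewrite le_max; apply/orP; left; nra.
rewrite le_max; apply/orP; right.
have: k^-1 * G <= k * D by rewrite ler_pdivrMl; [rewrite mulrA -expr2 | lra].
nra.
Qed.

(* Bernoulli's inequality, applied to [(1 - x)^-1]. *)
Lemma pow_one_sub_le (x : R) m : 0 <= x -> x <= 1 -> (1 - x) ^+ m * (1 + m%:R * x) <= 1.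
Proof.
move=> x0 x1; elim: m => [|m IHm]; first by rewrite expr0; lra.
apply: le_trans IHm; rewrite exprSr -mulrA ler_wpM2l ?exprn_ge0 ?subr_ge0 //.
by rewrite -natr1; have : 0 <= (m%:R : R) by []; nra.
Qed.

(** The previous inequality at [x = 1 / k] and [m = k] gives a factor of at most [1 / 2] for [k]
    steps; [2 k] steps square it. *)
Lemma pow_gap k : (0 < k)%N -> (1 - k%:R^-1 : R) ^+ (k + k) <= 4^-1.
Proof.
move=> k0; have K : (1 : R) <= k%:R by rewrite ler1n.
have iv1 : (k%:R : R)^-1 <= 1 by rewrite invf_le1 //; lra.
have iv0 : 0 <= (k%:R : R)^-1 by rewrite invr_ge0.
have := pow_one_sub_le k iv0 iv1; rewrite mulfV; last by rewrite gt_eqF //; lra.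
rewrite exprD => h; have : 0 <= (1 - k%:R^-1 : R) ^+ k by rewrite exprn_ge0 ?subr_ge0.
nra.
Qed.

End Dispersion.

(** * Greedy insertion and local search *)

Section LocalSearch.
Variables (R : realType) (F : setfamily) (w : 'I_(gsize F) -> R).
Hypothesis w_ge0 : forall i, (0 <= w i)%R.
Local Open Scope ring_scope.
Implicit Types (X Y Z : {set 'I_(gsize F)}) (A B : seq {set 'I_(gsize F)}).
Local Notation d := (dw w).
Local Notation dist_to := (dist_to w).
Local Notation cross := (cross w).

Definition solution A := uniq A && all (fun Y => Y \in feasible F) A.

Lemma solution_perm A B : perm_eq A B -> solution A = solution B.
Proof. by move=> AB; rewrite /solution (perm_uniq AB) (perm_all _ AB). Qed.

Definition best_addition A Y :=
  [/\ Y \in feasible F, Y \notin A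
    & forall X, X \in feasible F -> X \notin A ->
        wsum (dweight w A) X <= wsum (dweight w A) Y].

Lemma best_addition_dist A X Y : best_addition A Y -> X \in feasible F -> X \notin A ->
  dist_to X A <= dist_to Y A.
Proof. by move=> [_ _ best] XF XA; rewrite !dist_toE lerD2r best. Qed.

Lemma best_addition_perm A B Y : perm_eq A B -> best_addition A Y -> best_addition B Y.
Proof.
move=> AB [YF YA best]; split=> //; first by rewrite -(perm_mem AB).
have E : dweight w B = dweight w A.
  by apply: funext => i; apply: perm_big; rewrite perm_sym.
by move=> X XF; rewrite -(perm_mem AB) E; apply: best.
Qed.

Lemma solution_best_addition A Y : best_addition A Y -> solution A -> solution (Y :: A).
Proof. by move=> [YF YA _]; rewrite /solution /= YF YA. Qed.

(** The latest addition stands first. The first set added is an arbitrary feasible one, since the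
    weights for the empty list are 0. *)
Fixpoint greedy A := if A is Y :: A' then best_addition A' Y /\ greedy A' else True.

(** For two sets, the optimal pair is joined through the first greedy set, from which no feasible
    set is farther than the second. *)
Lemma greedy_half A B : greedy A -> solution B -> size A = size B -> (size A <= 3)%N ->
  cross B B <= 2 * cross A A.
Proof.
have dist1 X Y : dist_to X [:: Y] = d X Y by rewrite /dist_to big_seq1.
have cross0 : cross [::] [::] = 0 by rewrite /cross big_nil.
have cross1 X : cross [:: X] [:: X] = 0.
  by rewrite cross_cons cross0 /dist_to big_nil mulr0 addr0.
have radius X Y1 Y2 : best_addition [:: Y1] Y2 -> X \in feasible F -> d X Y1 <= d Y2 Y1.
  move=> best XF; have [->|XY1] := eqVneq X Y1; first by rewrite dw_self dw_ge0.
  by rewrite -!dist1; apply: best_addition_dist => //; rewrite inE.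
case: A B => [|Y1 [|Y2 [|Y3 [|]]]] // [|O1 [|O2 [|O3 [|]]]] //; rewrite ?cross0 ?cross1 ?mulr0 //=.
  move=> [best _] /and4P[_ O1F O2F _] _ _.
  rewrite !cross_cons !cross0 !dist1 /dist_to !big_nil.
  have := dw_triangle w_ge0 O1 Y2 O2; rewrite (dw_sym w Y2).
  have := radius _ _ _ best O1F; have := radius _ _ _ best O2F; lra.
move=> [best3 [best2 _]] /andP[/= _ /and4P[O1F O2F O3F _]] _ _.
rewrite !cross_cons !cross0 !dist_to_cons /dist_to !big_nil.
have r1 := radius _ _ _ best2 O1F; have r2 := radius _ _ _ best2 O2F.
have r3 := radius _ _ _ best2 O3F.
(* The greedy choice covers sets outside the list; for [Y2] and [Y3] themselves the bound is the
   triangle inequality. *)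
have third X : X \in feasible F -> d X Y2 + d X Y3 <= d Y1 Y2 + d Y1 Y3.
  move=> XF; have tri := dw_triangle w_ge0 Y2 Y1 Y3.
  have [->|XY2] := eqVneq X Y2; first by rewrite dw_self (dw_sym w Y1 Y2); lra.
  have [->|XY3] := eqVneq X Y3.
    by rewrite dw_self (dw_sym w Y1 Y2) (dw_sym w Y3 Y2); lra.
  have := best_addition_dist best3 XF.
  by rewrite !inE negb_or XY2 XY3 !dist_to_cons /dist_to !big_nil !addr0 => /(_ isT).
have t1 := third _ O1F; have t2 := third _ O2F; have t3 := third _ O3F.
have tri X X' Y : d X X' <= d X Y + d X' Y by rewrite (dw_sym w X' Y); apply: dw_triangle.
(* Joining through [Y2] and [Y3] bounds the optimal total by [3 (d Y1 Y2 + d Y1 Y3)], joining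
   through [Y3] alone by [6 d Y2 Y3]; weights [2/3] and [1/3] give twice the greedy total. *)
have := tri O1 O2 Y3; have := tri O1 O2 Y2; have := tri O1 O3 Y3; have := tri O1 O3 Y2.
have := tri O2 O3 Y3; have := tri O2 O3 Y2; lra.
Qed.

(** Swapping [X] for [Y] changes [cross] by twice the difference of their distances to the rest, so
    [A'] gains at least as much as any single swap. *)
Definition improves A A' :=
  [/\ solution A', size A' = size A, cross A A <= cross A' A'
    & forall X Y, X \in A -> Y \in feasible F -> Y \notin rem X A ->
        2 * (dist_to Y (rem X A) - dist_to X (rem X A)) <= cross A' A' - cross A A].

Definition gap A B := ((size A)%:R - 1) * cross B B - ((size A)%:R + 1) * cross A A.

Lemma improves_gap A A' B e : (0 < size A)%N -> solution A -> solution B ->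
  size A = size B -> improves A A' -> 0 <= e ->
  gap A B <= e -> gap A' B <= (1 - (size A)%:R^-1) * e.
Proof.
move=> A0 /andP[uA _] /andP[uB /allP allB] sAB [_ sA' AA' gain] e0.
rewrite /gap sA'; apply: cross_swap_gap => // X Y XA YB; apply: gain => //.
exact: allB.
Qed.

(** The identity [(k - 1) (1 - 1/k^2) = (k + 1) (1 - 1/k)^2] turns the gap bound into the ratio
    [(1 - 1/k)^2], used for [k >= 4]. *)
Lemma approx_ratio_gap A B : (0 < size A)%N -> 
  ((size A <= 3)%N -> cross B B <= 2 * cross A A) ->
  gap A B <= ((size A)%:R - 1) * cross B B / (size A)%:R ^+ 2 ->
  approx_ratio R (size A) * cross B B <= cross A A.
Proof.
rewrite /gap /approx_ratio; move: (size A) => k k0 small big_gap.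
have K : (1 : R) <= k%:R by rewrite ler1n.
have kV : (k%:R : R) != 0 by rewrite gt_eqF //; lra.
have B0 := cross_ge0 w_ge0 B B.
case: (leqP k 3) => [k3|k4].
  have -> : Num.max (1 - 2 / k%:R) (1 / 2) = 1 / 2 :> R.
    apply: max_r; rewrite lerBlDr -lerBlDl ler_pdivlMr; last by lra.
    have : k%:R <= (3 : R) by rewrite ler_nat.
    lra.
  by have := small k3; lra.
have -> : Num.max (1 - 2 / k%:R) (1 / 2) = 1 - 2 / k%:R :> R.
  apply: max_l; rewrite lerBrDr -lerBrDl ler_pdivrMr; last by lra.
  have : 4 <= (k%:R : R) by rewrite ler_nat.
  lra.
apply: le_trans (_ : (1 - k%:R^-1) ^+ 2 * cross B B <= _).
  by rewrite ler_wpM2r //; have := sqr_ge0 (k%:R : R)^-1; nra.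
rewrite -(@ler_pM2l _ (k%:R + 1)); last by lra.
move: big_gap; rewrite lerBlDr -lerBlDl; apply: le_trans.
by rewrite le_eqVlt; apply/orP; left; apply/eqP; field.
Qed.

(** Dividing by [rho] moves the bound under the maximum, whose default 0 is covered because
    diversities are nonnegative. *)
Lemma opt_le k (Ys : k.-tuple {set 'I_(gsize F)}) rho : 0 < rho ->
  (forall B, solution B -> size B = k -> rho * cross B B <= cross Ys Ys) ->
  rho * opt w k <= dsum w Ys.
Proof.
move=> rho0 le_rho; rewrite -ler_pdivlMl //; apply: bigmax_le.
  by rewrite mulr_ge0 ?invr_ge0 ?(ltW rho0) //; have := cross_ge0 w_ge0 Ys Ys; rewrite -dsum_cross; lra.
move=> B sB; rewrite ler_pdivlMl //.
have := le_rho B sB (size_tuple B); rewrite -!dsum_cross; lra.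
Qed.

Lemma opt_ge0 k : 0 <= opt w k.
Proof. by rewrite /opt; exact: bigmax_ge_id. Qed.

End LocalSearch.

(** * The approximation algorithm *)

Section Algorithm.
Variables (P : cmd).

(* Marks the keys of the sets of [var 1] in the cells from 6 on; then [var 4] is
   the pair of the best score and the best unmarked set met so far.  Initially
   [var 4] is [VNat 0], for which the ill-typed comparison is false. *)
Definition best_cmd := block [::
  Write (Const 1) (efst (var 0));
  Call 2 dweight_cmd (epair (esnd (esnd (esnd (var 0)))) (var 1));
  Call 3 P (epair (efst (esnd (var 0))) (epair (efst (esnd (esnd (var 0)))) (var 2)));
  While (nonempty (var 1)) (block [::
    Call 5 key_cmd (efst (var 1));
    Write (Bin AddN (Const 6) (var 5)) (Const 1);
    Write (Const 1) (esnd (var 1))]);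
  While (nonempty (var 3)) (block [::
    Call 5 key_cmd (efst (var 3));
    If (Read (Bin AddN (Const 6) (var 5))) Skip (block [::
      Call 5 score_cmd (epair (var 2) (efst (var 3)));
      If (Bin LeR (var 5) (efst (var 4))) Skip
        (Write (Const 4) (epair (var 5) (efst (var 3))))]);
    Write (Const 3) (esnd (var 3))]);
  Write (Const 0) (epair (var 2) (var 4))].

(* [var 1] and [var 2] are the members already and not yet tried for removal;
   [var 6] is the pair of the best gain and the resulting list. *)
Definition improve_cmd := block [::
  Write (Const 2) (efst (var 0));
  Write (Const 6) (epair (Un RealOfNat (Const 0)) (var 2));
  While (nonempty (var 2)) (block [::
    Call 3 catrev_cmd (epair (var 1) (esnd (var 2)));
    Call 4 best_cmd (epair (var 3) (esnd (var 0)));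
    Call 5 score_cmd (epair (efst (var 4)) (efst (var 2)));
    Write (Const 5) (Bin SubR (efst (esnd (var 4))) (var 5));
    If (Bin LeR (var 5) (efst (var 6))) Skip
      (Write (Const 6) (epair (var 5) (epair (esnd (esnd (var 4))) (var 3))));
    Write (Const 1) (epair (efst (var 2)) (var 1));
    Write (Const 2) (esnd (var 2))]);
  Write (Const 0) (esnd (var 6))].

(* [var 3] runs through the powers of 2 up to k, so there are O(k log k)
   improvement steps. *)
Definition approx_cmd := block [::
  Write (Const 4) (efst (esnd (var 0)));
  Write (Const 2) (var 4);
  While (var 2) (block [::
    Call 5 best_cmd (epair (var 1) (var 0));
    Write (Const 1) (epair (esnd (esnd (var 5))) (var 1));
    Write (Const 2) (Bin SubN (var 2) (Const 1))]);
  Write (Const 3) (Const 1);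
  While (Bin LeN (var 3) (var 4)) (block [::
    Write (Const 3) (Bin AddN (var 3) (var 3));
    Write (Const 2) (Bin AddN (var 4) (var 4));
    While (var 2) (block [::
      Call 1 improve_cmd (epair (var 1) (var 0));
      Write (Const 2) (Bin SubN (var 2) (Const 1))])]);
  Write (Const 0) (var 1)].

Variables (R : realType) (F : setfamily).
Local Notation n := (gsize F).
Local Notation mem0 := (@mem0 R).
Implicit Types (w : 'I_n -> R) (X Y : {set 'I_n}) (A : seq {set 'I_n}).

Definition finds_top k T := forall w, exists Ys : k.-tuple {set 'I_n},
  computes F P (enc_instance w k) (fun u => u = enc_sets R Ys) T /\ is_top w Ys.

Variables (k T : nat).
Hypotheses (k_gt0 : 0 < k) (topP : finds_top k T).

Definition marks A : mem_of R := fun a => VNat (a \in map (@set_key _) A : nat).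

Lemma upd_marks A X : upd (marks A) (set_key X) (VNat 1) = marks (X :: A).
Proof. by apply: funext => a; rewrite /upd /marks in_cons; case: eqP. Qed.

(** Invariant of the scan, [A'] being the part already scanned: [v] stays [VNat 0] as long as only
    members of [A] have been met. *)
Definition best_found w A A' (v : value R) :=
  (v = VNat 0 /\ {subset A' <= A}) \/
  exists Y, [/\ Y \in A', Y \notin A, v = VPair (VReal (wsum w Y)) (enc_set R Y)
    & forall X, X \in A' -> X \notin A -> (wsum w X <= wsum w Y)%R].

Lemma best_found_skip w A A' v X : best_found w A A' v ->
  (X \in A \/ exists s, exists2 u, v = VPair (VReal s) u & (wsum w X <= s)%R) ->
  best_found w A (X :: A') v.
Proof.
move=> [[-> sub]|[Y [YA' YA -> best]]] H.
  by left; split=> // Z; rewrite inE => /predU1P[->|/sub //]; case: H => [|[s []]].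
right; exists Y; split=> //; first by rewrite inE YA' orbT.
move=> Z; rewrite inE => /predU1P[->|/best //] XA.
by case: H XA => [->//|[s [u [<- _]]]].
Qed.

Lemma best_found_take w A A' v X : best_found w A A' v -> X \notin A ->
  ~~ truthy (eval_bin LeR (VReal (wsum w X)) (eval_un Fst v)) ->
  best_found w A (X :: A') (VPair (VReal (wsum w X)) (enc_set R X)).
Proof.
move=> found XA better; right; exists X; split=> //; first by rewrite inE eqxx.
move=> Z; rewrite inE => /predU1P[->//|ZA'] ZA.
case: found better => [[-> /(_ _ ZA')]|[Y [_ _ -> best]]]; first by rewrite (negPf ZA).
rewrite /= lt0b -ltNge => /ltW; apply: le_trans; exact: best.
Qed.

(** [A] has fewer than [k] members, so one of the [k] distinct sets listed lies outside it; the best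
    such set also beats every set that is not listed. *)
Lemma is_top_best_addition w A A' (Ys : k.-tuple {set 'I_n}) v : size A < k ->
  is_top (dweight w A) Ys -> best_found (dweight w A) A A' v -> A' =i Ys ->
  exists2 Y, best_addition w A Y
    & v = VPair (VReal (wsum (dweight w A) Y)) (enc_set R Y).
Proof.
move=> sA [/andP[uY /allP YF] top] found A'Y.
case: found => [[_ sub]|[Y [YA' YA -> best]]].
  have := uniq_leq_size uY (fun X XY => sub X (etrans (A'Y X) XY)).
  by rewrite size_tuple leqNgt sA.
exists Y => //; split=> //; first by apply: YF; rewrite -A'Y.
move=> X XF XA; have [XY|XY] := boolP (X \in Ys); first by apply: best => //; rewrite A'Y.
by apply: top => //; rewrite -A'Y.
Qed.

Lemma best_cmdP w A : size A < k ->
  computes F best_cmd (VPair (enc_sets R A) (enc_instance w k))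
    (fun u => exists2 Y, best_addition w A Y
       & u = VPair (enc_weight (dweight w A))
               (VPair (VReal (wsum (dweight w A) Y)) (enc_set R Y)))
    (T + 800 * (n.+1 * k)).
Proof.
move=> sA; apply: (@computesP _ _ _ _ _ _ 5); rewrite /best_cmd /=; wp_steps.
wp_callee (dweight_cmdP F w A) => _ t1 -> t1B; wp_steps.
have [Ys [runP topYs]] := topP (dweight w A).
wp_callee runP => _ t2 -> t2B; wp_steps.
set v0 := VPair _ _; set W := enc_weight _.
apply: (@wp_while _ _ (fun j m => exists p q v5, [/\ size q = j, catrev p q = A &
    m = memx [:: v0; enc_sets R q; W; enc_sets R Ys; VNat 0; v5] (marks p)])
  (40 * n.+1 + 30) (size A)).
- by exists [::], A, (VNat 0).
- move=> i _ [p [[|X q] [v5 [//= [sp] pq ->]]]]; split=> //; wp_steps.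
  wp_callee (key_cmdP R F X) => _ t -> tB; wp_steps.
  (* The address [6 + key] lies past the six variables. *)
  apply: wp_write; rewrite /= (@upd_memx_size _ [:: _; _; _; _; _; _]) upd_marks; wp_steps.
  by split; [exists (X :: p), q, (VNat (set_key X)) | lia].
- by move=> _ [p [[|X q] [v5 [//= _ _ ->]]]].
move=> _ t3 [p [[|X q] [v5 [//= _ pA ->]]]] t3B; wp_steps.
have {pA}pA : p =i A by move=> X; rewrite -pA catrevE cats0 mem_rev.
apply: (@wp_while _ _ (fun j m => exists A' q v v6, [/\ size q = j, catrev A' q = Ys,
    best_found (dweight w A) A A' v &
    m = memx [:: v0; VNat 0; W; enc_sets R q; v; v6] (marks p)])
  (90 * n.+1 + 70) k).
- exists [::], Ys, (VNat 0), v5; split=> //; first by rewrite size_tuple.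
  by left.
- move=> i _ [A' [[|X q] [v [v6 [//= [sq] eqY found ->]]]]]; split=> //; wp_steps.
  wp_callee (key_cmdP R F X) => _ t -> tB; wp_steps.
  (* As [set_key] is injective, the mark at the key of [X] decides membership in [A]. *)
  apply: wp_if; rewrite /= add0n (mem_map (@set_key_inj _)) pA lt0b.
  case: ifP => /= XA; wp_steps.
    split; last by lia.
    exists (X :: A'), q, v, (VNat (set_key X)); split=> //.
    by apply: best_found_skip found _; left.
  wp_callee (score_cmdP F (dweight w A) X) => _ t' -> tB'; wp_steps.
  apply: wp_if; rewrite /=; case: ifP => /= better; wp_steps.
    split; last by lia.
    exists (X :: A'), q, v, (VReal (wsum (dweight w A) X)); split=> //.
    (* A successful comparison forces [v] to be a pair headed by a real. *)
    apply: best_found_skip found _; right; move: better.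
    by case: v => [//|//|[//|s|//] u] /=; rewrite lt0b; exists s, u.
  split; last by lia.
  pose s := wsum (dweight w A) X.
  exists (X :: A'), q, (VPair (VReal s) (enc_set R X)), (VReal s); split=> //.
  by apply: best_found_take found _ _; rewrite ?XA //= better.
- by move=> _ [A' [[|X q] [v [v6 [//= _ _ _ ->]]]]].
move=> _ t4 [A' [[|X q] [v [v6 [//= _ A'Y found ->]]]]] t4B; wp_steps.
have {}A'Y : A' =i Ys by move=> X; rewrite memtE -A'Y catrevE cats0 mem_rev.
have [Y bestY ->] := is_top_best_addition sA topYs found A'Y.
split; first by exists Y.
have nk : n.+1 * (size A).+1 <= n.+1 * k by rewrite leq_pmul2l.
have nA : n.+1 * size A <= n.+1 * k by rewrite leq_pmul2l // ltnW.
have nk1 : k <= n.+1 * k by rewrite leq_pmull.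
clear -nk nA nk1 k_gt0 sA t1B t2B t3B t4B; move: t1B t3B t4B => /=.
move: n.+1 (size A) sA nk nA nk1 => N a *; lia.
Qed.

Lemma improve_cmdP w A : solution A -> size A = k ->
  computes F improve_cmd (VPair (enc_sets R A) (enc_instance w k))
    (fun u => exists2 A', improves w A A' & u = enc_sets R A')
    (k * (T + 1200 * (n.+1 * k))).
Proof.
move=> solA sA; apply: (@computesP _ _ _ _ _ _ 6); rewrite /improve_cmd /=; wp_steps.
set v0 := VPair _ _.
(* The members in [p] have been tried; [A'] realizes the best gain [g] so far, starting from [A]
   itself with gain 0. *)
apply: (@wp_while _ _ (fun j m => exists p q v3 v4 v5 g A',
    [/\ catrev p q = A /\ size q = j,
        m = memx [:: v0; enc_sets R p; enc_sets R q; v3; v4; v5;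
                     VPair (VReal g) (enc_sets R A')] mem0,
        solution A' /\ size A' = size A,
        (0 <= g)%R /\ cross w A' A' = (cross w A A + 2 * g)%R
      & forall X Y, X \in p -> Y \in feasible F -> Y \notin rem X A ->
          (dist_to w Y (rem X A) - dist_to w X (rem X A) <= g)%R])
  (T + 1000 * (n.+1 * k)) k).
- exists [::], A, (VNat 0), (VNat 0), (VNat 0), 0%R, A; split=> //.
  by rewrite mulr0 addr0.
- move=> i _ [p [[|X q] [v3 [v4 [v5 [g [A' [[pA //= [sq]] -> [solA' sA'] [g0 gE] gP]]]]]]]].
  split=> //; wp_steps.
  have pX : perm_eq A (X :: catrev p q).
    rewrite -pA !catrevE -cat1s perm_catCA perm_cat2l; exact: perm_refl.
  have XA : X \in A by rewrite (perm_mem pX) inE eqxx.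
  have prest : perm_eq (rem X A) (catrev p q).
    by rewrite -(perm_cons X) -(permPl (perm_to_rem XA)).
  have srest : (size (catrev p q)).+1 = k by rewrite -sA (perm_size pX).
  wp_callee (catrev_cmdP F [seq enc_set R Y | Y <- p] [seq enc_set R Y | Y <- q]) => _ t1 -> t1B.
  have -> : catrev [seq enc_set R Y | Y <- p] [seq enc_set R Y | Y <- q]
      = [seq enc_set R Y | Y <- catrev p q] by rewrite !catrevE map_cat map_rev.
  wp_steps.
  have sk : size (catrev p q) < k by rewrite -srest.
  wp_callee (best_cmdP w sk) => _ t2 [Y bestY ->] t2B; wp_steps.
  wp_callee (score_cmdP F (dweight w (catrev p q)) X) => _ t3 -> t3B; wp_steps.
  set h := (_ - _)%R.
  (* Scores differ from distances by a constant that is the same for [X] and [Y]. *)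
  have hE : h = (dist_to w Y (rem X A) - dist_to w X (rem X A))%R.
    by rewrite !(dist_to_perm _ _ prest) !dist_toE /h; ring.
  have bestY' : best_addition w (rem X A) Y.
    by apply: best_addition_perm bestY; rewrite perm_sym.
  have hmax Z : Z \in feasible F -> Z \notin rem X A ->
      (dist_to w Z (rem X A) - dist_to w X (rem X A) <= h)%R.
    by move=> ZF ZA; rewrite hE lerD2r; apply: best_addition_dist bestY' ZF ZA.
  have tB : 6 + (t1 + (t2 + (t3 + 100))) <= T + 1000 * (n.+1 * k).
    have sp : size p < k by rewrite -srest catrevE size_cat size_rev; lia.
    have nk1 : k <= n.+1 * k by rewrite leq_pmull.
    have nk2 : n.+1 <= n.+1 * k by rewrite leq_pmulr.
    clear -sp nk1 nk2 t1B t2B t3B k_gt0; rewrite size_map in t1B.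
    move: n.+1 nk1 nk2 t1B t2B t3B => N *; lia.
  apply: wp_if; rewrite /=; case: ifP => /=; rewrite lt0b => hg; wp_steps.
    split; last by move: tB; lia.
    exists (X :: p), q; do 3!eexists; exists g, A'; split=> //.
    move=> X' Z; rewrite inE => /predU1P[-> ZF ZA|]; last exact: gP.
    by apply: le_trans (hmax Z ZF ZA) _.
  have {}hg : (g <= h)%R by apply: ltW; rewrite ltNge hg.
  split; last by move: tB; lia.
  exists (X :: p), q; do 3!eexists; exists h, (Y :: catrev p q); split=> //.
  + split; last by rewrite sA.
    apply: solution_best_addition bestY _.
    by move: solA; rewrite (solution_perm pX) /solution /= => /andP[/andP[_ ->] /andP[_ ->]].
  + split; first exact: le_trans hg.
    rewrite (cross_perm w pX) !cross_cons hE !(dist_to_perm _ _ prest); ring.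
  move=> X' Z; rewrite inE => /predU1P[-> //|Xp ZF ZA]; first exact: hmax.
  by apply: le_trans (gP _ _ Xp ZF ZA) _.
- by move=> _ [p [[|X q] [v3 [v4 [v5 [g [A' [[pA //= _] -> _ _ _]]]]]]]].
move=> _ t [p [[|X q] [v3 [v4 [v5 [g [A' [[pA //= _] -> [solA' sA'] [g0 gE] gP]]]]]]]] tB.
wp_steps; split.
  exists A'; split=> //; first by rewrite gE lerDl mulr_ge0.
  move=> X Y XA YF YA; have -> : (cross w A' A' - cross w A A = 2 * g)%R by rewrite gE; ring.
  by rewrite ler_pM2l //; apply: gP => //; rewrite -pA catrevE cats0 mem_rev in XA.
have nk1 : k <= n.+1 * k by rewrite leq_pmull.
move: tB => /= tB; clear -tB nk1 k_gt0; move: (n.+1 * k) nk1 tB => N nk1 tB.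
by have : 100 * k <= k * (200 * N); [rewrite mulnC leq_mul2l; lia | nia].
Qed.

Lemma approx_cmdP w : (forall i, 0 <= w i)%R ->
  computes F approx_cmd (enc_instance w k)
    (fun u => exists2 A, [/\ solution A, size A = k & forall B, solution B -> size B = k ->
         (approx_ratio R k * cross w B B <= cross w A A)%R] & u = enc_sets R A)
    (4000 * ((trunc_log 2 k).+1 * k ^ 2 * (T + n.+1 * k))).
Proof.
move=> w_ge0; apply: (@computesP _ _ _ _ _ _ 5); rewrite /approx_cmd /=; wp_steps.
set v0 := enc_instance w k.
apply: (@wp_while _ _ (fun j m => exists A v5,
    [/\ size A + j = k, solution A, greedy w A &
        m = memx [:: v0; enc_sets R A; VNat j; VNat 0; VNat k; v5] mem0])
  (T + 800 * (n.+1 * k) + 40) k).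
- by exists [::], (VNat 0).
- move=> j _ [A [v5 [sA solA grA ->]]]; split=> //; wp_steps.
  have Ak : size A < k by lia.
  wp_callee (best_cmdP w Ak) => _ t [Y bestY ->] tB; wp_steps.
  split; last by lia.
  exists (Y :: A); eexists; split; last by rewrite subn1.
  + by rewrite -[size _]/(size A).+1 -sA addSnnS.
  + exact: solution_best_addition bestY solA.
  by split.
- by move=> _ [A [v5 [_ _ _ ->]]].
move=> _ t1 [A0 [v5 [sA0 solA0 grA0 ->]]] t1B; rewrite addn0 in sA0; wp_steps.
pose scale B : R := ((k%:R - 1) * cross w B B)%R.
have scale_ge0 B : (0 <= scale B)%R by rewrite mulr_ge0 ?cross_ge0 // subr_ge0 ler1n.
(* The values [1, 2, 4, ...] of [var 3] not exceeding [k] give [J] rounds. *)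
pose J := (trunc_log 2 k).+1.
pose BI := k * (T + 1200 * (n.+1 * k)) + 40.
(* With [p] the current power of 2, the gap is at most [scale B / p^2]: a round of [2 k]
   improvements divides the bound by 4 while [p] doubles. *)
apply: (@wp_while _ _ (fun j m => exists A v2 v5,
    [/\ j <= J,
        m = memx [:: v0; enc_sets R A; v2; VNat (2 ^ (J - j)); VNat k; v5] mem0,
        solution A /\ size A = k, (cross w A0 A0 <= cross w A A)%R
      & forall B, solution B -> size B = k ->
          (gap w A B <= scale B / (2 ^ (J - j))%:R ^+ 2)%R])
  ((k + k) * (BI + 10) + 40) J).
- exists A0, (VNat 0), v5; split=> //; first by rewrite subnn.
  move=> B _ _; rewrite subnn /gap sA0 expr1n divr1 /scale lerBlDr lerDl.
  by rewrite mulr_ge0 ?cross_ge0 // addr_ge0.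
- move=> j _ [A [v2 [v5' [jJ -> [solA sA] A0A gapA]]]]; split.
    by rewrite /= lt0b; apply: leq_trans (@trunc_logP 2 k isT k_gt0); rewrite leq_exp2l // /J; lia.
  wp_steps; set p := 2 ^ (J - j.+1).
  have pE : p + p = 2 ^ (J - j) by rewrite addnn -mul2n -expnS /p; congr (2 ^ _); lia.
  apply: (@wp_while _ _ (fun i m => exists A',
      [/\ m = memx [:: v0; enc_sets R A'; VNat i; VNat (p + p); VNat k; v5'] mem0,
          solution A' /\ size A' = k, (cross w A0 A0 <= cross w A' A')%R, i <= k + k
        & forall B, solution B -> size B = k ->
            (gap w A' B <= (1 - k%:R^-1) ^+ (k + k - i) * (scale B / p%:R ^+ 2))%R])
    BI (k + k)).
  + exists A; split=> // B solB sB.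
    by rewrite subnn expr0 mul1r; apply: gapA.
  + move=> i _ [A' [-> [solA' sA'] A0A' ik gapA']]; split=> //; wp_steps.
    wp_callee (improve_cmdP w solA' sA') => _ t [A2 imp ->] tB; wp_steps.
    have [solA2 sA2 A'A2 _] := imp.
    split; last by rewrite /BI; lia.
    exists A2; split; rewrite ?subn1 ?(ltnW ik) ?sA2 //; first exact: le_trans A'A2.
    move=> B solB sB; rewrite -[in leRHS](subnSK ik) exprS -mulrA -sA'.
    apply: improves_gap imp _ _ => //; rewrite ?sA' ?sB //; last exact: gapA'.
    apply: mulr_ge0; last by rewrite divr_ge0 ?exprn_ge0.
    by apply: exprn_ge0; rewrite subr_ge0 invf_le1 ?ler1n ?ltr0n.
  + by move=> _ [A' [->]].
  move=> _ t [A' [-> [solA' sA'] A0A' _ gapA']] tB; wp_steps; split.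
    exists A', (VNat 0), v5'; rewrite -pE; split=> //; first exact: ltnW.
    move=> B solB sB; apply: le_trans (gapA' B solB sB) _; rewrite subn0.
    have -> : (scale B / (p + p)%:R ^+ 2 = 4^-1 * (scale B / p%:R ^+ 2))%R.
      have -> : ((p + p)%:R = 2 * p%:R :> R)%R by rewrite natrD; ring.
      by rewrite exprMn invfM mulrCA (_ : 2 ^+ 2 = 4)%R //; ring.
    rewrite ler_wpM2r ?pow_gap // mulr_ge0 ?invr_ge0 ?exprn_ge0 //.
  by move: tB => /=; lia.
- move=> _ [A [v2 [v5' [_ -> _ _ _]]]] /=; rewrite lt0b -ltnNge subn0.
  exact: trunc_log_ltn.
move=> _ t2 [A [v2 [v5' [_ -> [solA sA] A0A gapA]]]] t2B; wp_steps; split.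
  exists A => //; split=> // B solB sB; rewrite -sA; apply: approx_ratio_gap => //; rewrite ?sA //.
    (* Improvements never lose diversity, so the guarantee of the greedy start persists. *)
    move=> k3; apply: le_trans (_ : 2 * cross w A0 A0 <= _)%R; last by rewrite ler_pM2l.
    by apply: greedy_half; rewrite ?sA0 ?sB.
  (* The final power [2 ^ J] exceeds [k]. *)
  apply: le_trans (gapA B solB sB) _; rewrite -/(scale B) ler_wpM2l //.
  rewrite lef_pV2 ?posrE ?exprn_gt0 ?ltr0n ?expn_gt0 //.
  by rewrite lerXn2r ?nnegrE // ler_nat subn0 ltnW // trunc_log_ltn.
move: t1B t2B; rewrite /= /BI -/J; clear -k_gt0; have : 0 < J by [].
move: J => j j0; have nk1 : k <= n.+1 * k by rewrite leq_pmull.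
move: (n.+1 * k) nk1 => N kN t1B t2B.
rewrite -mulnn -(mulnA j); set D := k * k * (T + N).
have kS : k * (T + N) <= D by rewrite /D -mulnA leq_pmull.
have kD : k <= D by apply: leq_trans kS; rewrite leq_pmulr //; lia.
have {}t1B : t1 <= 850 * D.
  apply: leq_trans t1B _; apply: leq_trans (_ : 800 * (k * (T + N)) + 46 * k <= _); lia.
have {}t2B : t2 <= j * (2600 * D) + 6.
  apply: leq_trans t2B _; apply: leq_add => //; rewrite leq_mul2l; apply/orP; right.
  apply: leq_trans (_ : 2400 * D + 200 * k <= _); last by lia.
  by rewrite /D; nia.
have jD : D <= j * D by rewrite leq_pmull.
by lia.
Qed.

End Algorithm.

(** * Running times *)

Section OutputTime.
Variables (R : realType) (F : setfamily) (p : pred (value R)).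

Fixpoint car_run (v : value R) : nat :=
  if v is VPair a b then if p a then (car_run b).+1 else 0 else 0.

(** A measure that one step raises by at most one. The size of a value would not do, as pairing a
    value with itself doubles it. The maximum over all subvalues makes the measure monotone under
    projections. *)
Fixpoint max_car_run (v : value R) : nat :=
  if v is VPair a b then maxn (car_run v) (maxn (max_car_run a) (max_car_run b)) else 0.

Lemma car_run_le_max v : car_run v <= max_car_run v.
Proof. by case: v => //= a b; rewrite leq_max leqnn. Qed.

Lemma max_car_run_pair a b : max_car_run (VPair a b) <= (maxn (max_car_run a) (max_car_run b)).+1.
Proof.
rewrite /= geq_max leqnSn andbT; case: ifP => // _; rewrite ltnS.
exact: leq_trans (car_run_le_max b) (leq_maxr _ _).
Qed.

Lemma max_car_run_eval (m : mem_of R) N e : (forall a, max_car_run (m a) <= N) ->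
  max_car_run (eval F m e) <= N + ecost e.
Proof.
move=> mN; elim: e => [a|e _|o e IHe|o e1 IH1 e2 IH2|e _|e _] //=.
- exact: leq_trans (leq_addr _ _).
- apply: leq_trans (leq_trans IHe _); last by rewrite leq_add2l.
  by case: o; case: (eval F m e) => //= a b; rewrite !leq_max leqnn ?orbT.
case: o; try by case: (eval F m e1) => // x; case: (eval F m e2).
have -> : eval_bin MkPair (eval F m e1) (eval F m e2) = VPair (eval F m e1) (eval F m e2).
  by case: (eval F m e1).
apply: leq_trans (max_car_run_pair _ _) _; rewrite addnS ltnS geq_max.
by rewrite (leq_trans IH1) ?(leq_trans IH2) // leq_add2l ?leq_addl ?leq_addr.
Qed.

Lemma max_car_run_upd (m : mem_of R) N x v : (forall a, max_car_run (m a) <= N) ->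
  max_car_run v <= N -> forall a, max_car_run (upd m x v a) <= N.
Proof. by move=> mN vN a; rewrite /upd; case: ifP. Qed.

Lemma max_car_run_init v a : max_car_run (init_mem v a) <= max_car_run v.
Proof. by rewrite /init_mem; case: ifP. Qed.

Lemma max_car_run_exec c m m' t : exec F c m m' t ->
  forall N, (forall a, max_car_run (m a) <= N) -> forall a, max_car_run (m' a) <= N + t.
Proof.
have mono (m0 : mem_of R) N N' : N <= N' -> (forall a, max_car_run (m0 a) <= N) ->
    forall a, max_car_run (m0 a) <= N'.
  by move=> NN mN a; apply: leq_trans NN.
elim=> {c m m' t}.
- by move=> m N mN; apply: mono mN; rewrite leq_addr.
- move=> m a e N mN; apply: max_car_run_upd; first by apply: mono mN; rewrite leq_addr.
  by apply: leq_trans (max_car_run_eval e mN) _; lia.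
- by move=> c1 c2 m m1 m2 t1 t2 _ IH1 _ IH2 N mN; rewrite addnA; apply: IH2; apply: IH1.
- by move=> e c1 c2 m m1 t _ IH N /IH; apply: mono; lia.
- by move=> e c m _ N mN; apply: mono mN; rewrite leq_addr.
- move=> e c m m1 m2 t1 t2 _ _ IH1 _ IH2 N mN; apply: (mono _ (N + t1 + t2)); first by lia.
  by apply: IH2; apply: IH1.
move=> x c e m m1 t _ IH N mN; apply: max_car_run_upd; first by apply: mono mN; rewrite leq_addr.
apply: leq_trans (IH (N + ecost e) _ 0) _; last by lia.
by move=> a; apply: leq_trans (max_car_run_init _ _) (max_car_run_eval _ mN).
Qed.

Lemma outputs_max_car_run c vin vout t :
  outputs F c vin vout t -> max_car_run vout <= max_car_run vin + t.
Proof. by move=> [m [ex <-]]; apply: max_car_run_exec ex _ _ _ => a; apply: max_car_run_init. Qed.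

Lemma car_run_enc_map T (f : T -> value R) s : (forall x, p (f x)) ->
  car_run (enc_seq [seq f x | x <- s]) = size s.
Proof. by move=> pf; elim: s => //= x s ->; rewrite pf. Qed.

End OutputTime.

Section TopTime.
Variables (R : realType) (F : setfamily).
Local Notation n := (gsize F).

Definition is_nat (v : value R) := if v is VNat _ then true else false.
Definition is_pair (v : value R) := if v is VPair _ _ then true else false.

Lemma max_car_run_weight p T (w : T -> R) s : (forall x, ~~ p (VReal x)) ->
  max_car_run p (enc_seq [seq VReal (w i) | i <- s]) = 0.
Proof. by move=> pN; elim: s => //= i s ->; rewrite (negPf (pN _)). Qed.

Lemma exec_gt0 c (m m' : mem_of R) t : exec F c m m' t -> 0 < t.
Proof. by elim=> // c1 c2 ? ? ? ? ? _ t0 _ _; rewrite ltn_addr. Qed.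

(* Runs of naturals or of pairs in list position grow by at most one per step,
   and are short in the input; so the output must be paid for. *)
Lemma outputs_topk_time c (w : 'I_n -> R) k (Ys : k.-tuple {set 'I_n}) t :
  0 < k -> is_solution Ys ->
  outputs F c (enc_instance w k) (enc_sets R Ys) t -> n + k <= 4 * t.
Proof.
move=> k0 solY out; have t0 : 0 < t by case: out => m [/exec_gt0].
(* The input begins with two naturals, whence the 2; the bit vector of a set is a run of [n]
   naturals. *)
have nt : n <= t + 2.
  have := outputs_max_car_run is_nat out; rewrite /enc_instance /= max_car_run_weight //.
  case: Ys {solY out} => -[|Y s] /= sz; first by rewrite -(eqP sz) in k0.
  have : n <= max_car_run is_nat (enc_set R Y).
    apply: leq_trans (car_run_le_max _ _); rewrite car_run_enc_map ?size_enum_ord //.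
  have -> : car_run is_nat (enc_weight w) = 0.
    by apply/eqP; rewrite -leqn0 -(max_car_run_weight (p := is_nat) w (enum 'I_n)) // car_run_le_max.
  by lia.
(* On the empty ground set a set is encoded as [VNat 0], which is no pair; but then there is only
   one set. *)
have [n0|n_gt0] := posnP n.
  have k1 : k <= 1.
    have /andP[uY _] := solY; rewrite -(size_tuple Ys) -(card_uniqP uY).
    apply/card_le1_eqP => X Y _ _; apply/setP => i.
    by have := leq_trans (ltn_ord i) (eq_leq n0).
  lia.
(* The output is a run of [k] pairs, and no pair stands in list position in the input. *)
have : k <= t; last by lia.
have := outputs_max_car_run is_pair out; rewrite /enc_instance /= max_car_run_weight //.
apply: leq_trans; apply: leq_trans (car_run_le_max _ _).
rewrite car_run_enc_map ?size_tuple // => Y; rewrite /enc_set.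
by case: (enum 'I_n) (size_enum_ord n) n_gt0 => //= <-.
Qed.

End TopTime.

(** * Comparison of time bounds *)

Section Bounds.
Variable R : realType.
Local Open Scope ring_scope.

Lemma poly_time_le (C C' : R) d d' n k : (0 < n + k)%N -> C <= C' -> 0 <= C' -> (d <= d')%N ->
  poly_time C d n k <= poly_time C' d' n k.
Proof.
move=> nk CC C0 dd; have nk1 : 1 <= (n + k)%:R :> R by rewrite ler1n.
apply: le_trans (_ : C' * (n + k)%:R ^+ d <= _); first by rewrite ler_wpM2r ?exprn_ge0.
by rewrite ler_wpM2l // ler_weXn2l.
Qed.

Lemma poly_time_add (C : R) (a d n k : nat) : (0 < n + k)%N ->
  poly_time C d n k + a%:R <= poly_time (C + a%:R) d n k.
Proof.
move=> nk; rewrite /poly_time mulrDl lerD2l ler_peMr //.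
by rewrite exprn_ege1 // ler1n.
Qed.

Lemma ln_nat_le k : (0 < k)%N -> ln k%:R <= k%:R :> R.
Proof.
move=> k0; have := @le_ln1Dx R (k%:R - 1); rewrite addrCA subrr addr0 => h.
have K : 0 < k%:R :> R by rewrite ltr0n.
by apply: le_trans (h _) _; lra.
Qed.

Lemma approx_time_poly (c : R) : exists d, forall n k, (0 < k)%N ->
  approx_time c n k <= (n + k)%:R ^+ d.
Proof.
(* The exponents are those of the factors [(n + k)^c], [n], [k^2] and [log k]. *)
pose N := (Num.trunc c).+1; exists (N + 1 + 2 + 1)%N => n k k0.
have k1 : (1 : R) <= k%:R by rewrite ler1n.
have nk1 : (1 : R) <= (n + k)%:R by rewrite ler1n addn_gt0 k0 orbT.
have knk : (k%:R : R) <= (n + k)%:R by rewrite ler_nat leq_addl.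
rewrite !exprD !expr1 /approx_time; apply: ler_pM; last 1 first.
- by rewrite ge_max nk1; apply: le_trans (ln_nat_le k0) knk.
- by rewrite !mulr_ge0 ?powR_ge0.
- by rewrite le_max ler01.
apply: ler_pM; rewrite ?lerXn2r ?nnegrE ?exprn_ge0 //; first by rewrite mulr_ge0 ?powR_ge0.
apply: ler_pM; rewrite ?powR_ge0 //; last first.
  by rewrite ler_nat geq_max leq_addr addn_gt0 k0 orbT.
by rewrite -powR_mulrn ?ler0n // ler_powR // ltW // truncnS_gt.
Qed.

(** From [2 ^ trunc_log 2 k <= k] on taking logarithms; the extra 1 is covered by the maximum. *)
Lemma trunc_log_ln k : (0 < k)%N ->
  (trunc_log 2 k).+1%:R <= (1 + (ln 2)^-1) * Num.max 1 (ln k%:R) :> R.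
Proof.
move=> k0; have l2 : 0 < ln 2 :> R by rewrite ln_gt0 // ltr1n.
have m1 : 1 <= Num.max 1 (ln k%:R) :> R by rewrite le_max lexx.
rewrite -natr1 addrC mulrDl mul1r lerD //.
rewrite ler_pdivlMl // mulrC; apply: le_trans (_ : ln k%:R <= _); last by rewrite le_max lexx orbT.
rewrite -[leLHS]/(_ * _) mulr_natl -lnXn ?ltr0n // ler_ln ?posrE ?exprn_gt0 ?ltr0n //.
by rewrite -natrX ler_nat trunc_logP.
Qed.

End Bounds.

Lemma approx_cmd_approximates (R : realType) cls (P : cmd) (C c : R) :
  solves_topk cls P (fun n k => C * topk_time c n k)%R ->
  exists C', approximates cls (approx_cmd P) (approx_ratio R)
    (fun n k => C' * approx_time c n k)%R.
Proof.
move=> topP; have := @approx_cmdP P R; move: 4000 => K approxP.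
(* The 9 comes from [T + (n + 1) k <= 9 T max(1, n)], using [k <= 4 T]; the logarithmic factor is
   that of [trunc_log_ln]. *)
exists (K%:R * 9 * (1 + (ln 2)^-1) * C)%R => F w k clsF w_gt0 vk; have [k0 kF] := vk.
set bound := (C * topk_time c (gsize F) k)%R; pose T := Num.trunc bound.
(* One enumeration, for [w] itself, shows that the bound is nonnegative and large enough to absorb
   the extra work. *)
have [Ys0 [t0 [out0 [sol0 _] t0B]]] := topP F w k clsF vk.
have bound_ge0 : (0 <= bound)%R by apply: le_trans t0B.
have nkT : gsize F + k <= 4 * T.
  apply: leq_trans (outputs_topk_time k0 sol0 out0) _.
  by rewrite leq_mul2l truncn_ge_nat.
have findP : finds_top P R F k T.
  move=> w'; have [Ys [t [[m [ex mE]] top tB]]] := topP F w' k clsF vk.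
  exists Ys; split=> //; exists m, t; split=> //; split=> //.
  by rewrite truncn_ge_nat.
have w_ge0 i : (0 <= w i)%R by apply: ltW.
have [m [t [ex [[A [solA sA apxA] mE] tB]]]] := approxP F k T k0 findP w w_ge0.
exists (Tuple (introT eqP sA)), t; split=> //.
- by exists m.
- apply: opt_le => //.
  by rewrite /approx_ratio lt_max divr_gt0 ?orbT.
have {}tB : t <= K * 9 * ((trunc_log 2 k).+1 * k ^ 2 * (T * maxn 1 (gsize F))).
  apply: leq_trans tB _; rewrite -(mulnA K) leq_mul2l; apply/orP; right.
  rewrite [9 * _]mulnCA leq_mul2l; apply/orP; right.
  have kT : k <= 4 * T by lia.
  have n1 : (gsize F).+1 <= 2 * maxn 1 (gsize F) by lia.
  have := leq_mul n1 kT; have : 0 < maxn 1 (gsize F) by rewrite leq_max.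
  by move: (maxn _ _) => N N0; nia.
have {}tB : (t%:R <= K%:R * 9 * ((trunc_log 2 k).+1%:R * k%:R ^+ 2 * (T%:R * (maxn 1 (gsize F))%:R)) :> R)%R.
  by rewrite -natrX -!natrM ler_nat.
apply: le_trans tB _.
rewrite /approx_time -/(topk_time c (gsize F) k).
set L := (1 + _)%R; set M := (maxn _ _)%:R%R; set J := (_.+1%:R)%R; set l := Num.max _ _.
rewrite [leRHS](_ : _ = K%:R * 9 * (L * l * k%:R ^+ 2 * (bound * M)))%R; last by rewrite /bound; ring.
rewrite ler_wpM2l ?mulr_ge0 //; apply: ler_pM; rewrite ?mulr_ge0 ?exprn_ge0 ?ler0n //.
  by rewrite ler_wpM2r ?exprn_ge0 // trunc_log_ln.
by rewrite ler_wpM2r ?ler0n // truncn_le.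
Qed.

(** * Approximation schemes *)

Section Dispatch.
Variables (R : realType) (F : setfamily) (w : 'I_(gsize F) -> R) (k : nat).
Local Open Scope ring_scope.

Implicit Types (vin vout : value R).

(** Calls give each branch a fresh memory holding exactly the input it is specified for. *)
Definition dispatch_cmd e c1 c2 e1 := If e (Call 0 c1 e1) (Call 0 c2 e1).

Definition dispatch_cost e e1 := (ecost e + ecost e1).+2.

Lemma dispatch_outputs e c1 c2 e1 vin vout t :
  let m := init_mem vin in
  outputs F (if truthy (eval F m e) then c1 else c2) (eval F m e1) vout t ->
  outputs F (dispatch_cmd e c1 c2 e1) vin vout (t + dispatch_cost e e1).
Proof.
move=> m [m' [ex <-]]; exists (upd m 0 (m' 0%N)); split=> //.
have -> : (t + dispatch_cost e e1 = (ecost e + (ecost e1 + t).+1).+1)%N.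
  by rewrite /dispatch_cost; lia.
by apply: exec_if; move: ex; case: ifP => _; apply: exec_call.
Qed.

(** The overhead is constant and is absorbed into [C'] because [n + k >= 1]. *)
Lemma dispatch_approximates e c1 c2 e1 vin rho rho' C C' d d' :
  let m := init_mem vin in
  approximates_on w k (if truthy (eval F m e) then c1 else c2) (eval F m e1) rho
    (poly_time C d (gsize F) k) ->
  rho' <= rho -> (0 < k)%N -> 0 <= C' -> C + (dispatch_cost e e1)%:R <= C' -> (d <= d')%N ->
  approximates_on w k (dispatch_cmd e c1 c2 e1) vin rho' (poly_time C' d' (gsize F) k).
Proof.
move=> m [Ys [t [out sol apx tT]]] rr k0 C0 CC dd.
exists Ys, (t + dispatch_cost e e1)%N; split=> //.
- exact: dispatch_outputs.
- apply: le_trans apx; rewrite ler_wpM2r // opt_ge0 //.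
have nk : (0 < gsize F + k)%N by rewrite addn_gt0 k0 orbT.
apply: le_trans (poly_time_le nk CC C0 dd); apply: le_trans (poly_time_add _ _ _ nk).
by rewrite natrD lerD2r.
Qed.

Lemma solves_exactly_approximates c T eps : 0 <= eps ->
  solves_exactly_on w k c T -> approximates_on w k c (enc_instance w k) (1 - eps) T.
Proof.
move=> eps0 [Ys [t [out sol apx tT]]]; exists Ys, t; split=> //.
by rewrite apx ler_piMl ?opt_ge0 // gerBl.
Qed.

Lemma approximates_on_le c vin rho C C' d d' : (0 < k)%N ->
  approximates_on w k c vin rho (poly_time C d (gsize F) k) ->
  C <= C' -> 0 <= C' -> (d <= d')%N ->
  approximates_on w k c vin rho (poly_time C' d' (gsize F) k).
Proof.
move=> k0 [Ys [t [out sol apx tT]]] CC C0 dd; exists Ys, t; split=> //.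
by apply: le_trans tT _; apply: poly_time_le; rewrite ?addn_gt0 ?k0 ?orbT.
Qed.

End Dispatch.

Section Schemes.
Variables (R : realType) (cls : setfamily -> Prop).
Local Open Scope ring_scope.

Definition approximates_below K (c : cmd) (rho C : R) d :=
  forall (F : setfamily) (w : 'I_(gsize F) -> R) k,
    (k < K)%N -> cls F -> (forall i, 0 < w i) -> valid_k F k ->
    approximates_on w k c (enc_instance w k) rho (poly_time C d (gsize F) k).

(** The constant and degree depend on [k]; their maxima over the finitely many [k < K] serve all of
    them. *)
Lemma exact_uniform_below c eps K : 0 <= eps ->
  (forall k, solves_exactly_at R cls c k) ->
  exists C d, 0 <= C /\ approximates_below K c (1 - eps) C d.
Proof.
move=> eps0 exact_c; elim: K => [|K [C [d [C0 IHK]]]]; first by exists 0, 0%N.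
have [C1 [d1 cK]] := exact_c K.
exists (Num.max C C1), (maxn d d1); split; first by rewrite le_max C0.
move=> F w k; rewrite ltnS leq_eqVlt => /predU1P[->|kK] clsF w0 vk.
  apply: (approximates_on_le (d := d1) (C := C1)); rewrite ?le_max ?lexx ?C0 ?orbT ?leq_maxr //.
    by case: vk.
  exact: solves_exactly_approximates (cK F w clsF w0 vk).
apply: (approximates_on_le (d := d) (C := C)); rewrite ?le_max ?lexx ?C0 ?leq_maxl //.
  by case: vk.
exact: IHK.
Qed.

Definition size_bound K := Bin LeN (Const K) (efst (esnd (var 0))).

(** The programs for the finitely many [k < K] are nested, with a test on [k] for each. *)
Lemma exact_each_below eps K : 0 <= eps -> exact_each R cls ->
  exists c C d, 0 <= C /\ approximates_below K c (1 - eps) C d.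
Proof.
move=> eps0 exact_c; elim: K => [|K [c [C [d [C0 IHK]]]]]; first by exists Skip, 0, 0%N.
have [c1 [C1 [d1 cK]]] := exact_c K.
pose a : R := (dispatch_cost (size_bound K) (var 0))%:R.
exists (dispatch_cmd (size_bound K) c1 c (var 0)), (Num.max C C1 + a), (maxn d d1).
have C'0 : 0 <= Num.max C C1 + a by rewrite addr_ge0 // le_max C0.
split=> // F w k kK clsF w0 vk; have k0 : (0 < k)%N by case: vk.
have [Kk|kK'] := leqP K k.
  have {}kK : k = K by lia.
  apply: (@dispatch_approximates _ _ _ _ _ _ _ _ _ (1 - eps) _ C1 _ d1) => //.
  + rewrite /= Kk; apply: solves_exactly_approximates => //.
    by rewrite kK in vk *; apply: cK.
  + by rewrite lerD2r le_max lexx orbT.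
  + exact: leq_maxr.
apply: (@dispatch_approximates _ _ _ _ _ _ _ _ _ (1 - eps) _ C _ d) => //.
+ by rewrite /= (leqNgt K) kK' /=; apply: IHK.
+ by rewrite lerD2r le_max lexx.
+ exact: leq_maxl.
Qed.

Lemma approx_ratio_large (eps : R) k : (0 < k)%N -> 2 <= eps * k%:R ->
  1 - eps <= approx_ratio R k.
Proof.
move=> k0 ek; rewrite /approx_ratio le_max; apply/orP; left.
by rewrite lerD2l lerN2 ler_pdivrMr // ltr0n.
Qed.

(** [K] can be written into a program when [eps] is fixed; for [eps] given as input, the equivalent
    comparison can be tested without rounding. *)
Lemma eps_bound (eps : R) : 0 < eps -> exists K, forall k, (K <= k)%N = (2 <= eps * k%:R).
Proof.
move=> e0.
have ex : exists k : nat, 2 <= eps * k%:R.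
  by exists (Num.trunc (2 / eps)).+1; rewrite -ler_pdivrMl // mulrC ltW // truncnS_gt.
exists (ex_minn ex) => k; case: ex_minnP => K KP Kmin; apply/idP/idP; last exact: Kmin.
by move=> Kk; apply: le_trans KP _; rewrite ler_pM2l // ler_nat.
Qed.

Variables (capx : cmd) (Ca : R) (da : nat).
Hypothesis apxP : approximates cls capx (approx_ratio R) (poly_time Ca da).

Lemma scheme_each : exact_each R cls -> ptas_each R cls.
Proof.
move=> exact_c eps e0; have [K KP] := eps_bound e0.
have [c [C [d [C0 cP]]]] := exact_each_below K (ltW e0) exact_c.
pose a : R := (dispatch_cost (size_bound K) (var 0))%:R.
exists (dispatch_cmd (size_bound K) capx c (var 0)), (Num.max C Ca + a), (maxn d da).
have C'0 : 0 <= Num.max C Ca + a by rewrite addr_ge0 // le_max C0.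
move=> F w k clsF w0 vk; have k0 : (0 < k)%N by case: vk.
have [Kk|kK] := leqP K k.
  apply: (@dispatch_approximates _ _ _ _ _ _ _ _ _ (approx_ratio R k) _ Ca _ da) => //.
  + by rewrite /= Kk; apply: apxP.
  + by apply: approx_ratio_large; rewrite -?KP.
  + by rewrite lerD2r le_max lexx orbT.
  + exact: leq_maxr.
apply: (@dispatch_approximates _ _ _ _ _ _ _ _ _ (1 - eps) _ C _ d) => //.
+ by rewrite /= (leqNgt K) kK /=; apply: cP.
+ by rewrite lerD2r le_max lexx.
+ exact: leq_maxl.
Qed.

(** Since [eps] is now input, the program compares [2] with [eps * k] and passes on the instance
    stripped of [eps]. *)
Lemma scheme_uniform : exact_uniform R cls -> ptas_uniform R cls.
Proof.
move=> [c exact_c].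
pose test := Bin LeR (Un RealOfNat (Const 2))
  (Bin MulR (efst (var 0)) (Un RealOfNat (efst (esnd (esnd (var 0)))))).
exists (dispatch_cmd test capx c (esnd (var 0))) => eps e0; have [K KP] := eps_bound e0.
have [C [d [C0 cP]]] := exact_uniform_below K (ltW e0) exact_c.
pose a : R := (dispatch_cost test (esnd (var 0)))%:R.
exists (Num.max C Ca + a), (maxn d da).
have C'0 : 0 <= Num.max C Ca + a by rewrite addr_ge0 // le_max C0.
move=> F w k clsF w0 vk; have k0 : (0 < k)%N by case: vk.
have [Kk|kK] := leqP K k.
  apply: (@dispatch_approximates _ _ _ _ _ _ _ _ _ (approx_ratio R k) _ Ca _ da) => //.
  + by rewrite /= -KP Kk; apply: apxP.
  + by apply: approx_ratio_large; rewrite -?KP.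
  + by rewrite lerD2r le_max lexx orbT.
  + exact: leq_maxr.
apply: (@dispatch_approximates _ _ _ _ _ _ _ _ _ (1 - eps) _ C _ d) => //.
+ by rewrite /= -KP (leqNgt K) kK /=; apply: cP.
+ by rewrite lerD2r le_max lexx.
+ exact: leq_maxl.
Qed.

End Schemes.

Local Open Scope ring_scope.

Theorem theorem2 (R : realType) (cls : setfamily -> Prop) (c : R)
    (topk : exists (P : cmd) (C : R),
        solves_topk cls P (fun n k => C * topk_time c n k)) :
  (exists (P : cmd) (C : R),
      approximates cls P (approx_ratio R) (fun n k => C * approx_time c n k))
  /\ (exact_uniform R cls -> ptas_uniform R cls)
  /\ (exact_each R cls -> ptas_each R cls).
Proof.
have [P [C topP]] := topk; have [C' apxP] := approx_cmd_approximates topP.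
split; first by exists (approx_cmd P), C'.
have [d dP] := approx_time_poly c.
(* The absolute value is taken because the sign of [C'] is not known. *)
have apx : approximates cls (approx_cmd P) (approx_ratio R) (poly_time `|C'| d).
  move=> F w k clsF w0 vk; have [Ys [t [out sol apx tT]]] := apxP F w k clsF w0 vk.
  exists Ys, t; split=> //; apply: le_trans tT _.
  have k0 : (0 < k)%N by case: vk.
  apply: le_trans (_ : `|C'| * approx_time c (gsize F) k <= _); last by rewrite ler_wpM2l ?dP.
  rewrite ler_wpM2r ?ler_norm //.
  by rewrite /approx_time !mulr_ge0 ?powR_ge0 // le_max ler01.
by split; [exact: scheme_uniform apx | exact: scheme_each apx].
Qed.
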